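(* Assume the following statement (the $(3,3)$ Conjecture): for every odd prime $q$ and every quadratic imaginary number field $L$ with $d_q\mathrm{Cl}(L)=2$, the $q$-tower group $\mathrm{Gal}(L_q^{(\infty)}/L)$ is finite if and only if it is of Zassenhaus type $(3,3)$. Let $p>3$ be a prime, let $K$ be a quadratic imaginary number field with $d_p\mathrm{Cl}(K)=2$, let $G=\mathrm{Gal}(K_p^{(\infty)}/K)$ and let $\{\chi_1,\chi_2\}$ be a basis of $H^1(G,\mathbb{F}_p)$. Let $1\to R\to F\to G\to 1$ be a minimal presentation of $G$, with $F$ a free pro-$p$-group on two generators, and let $\rho_1,\rho_2\in R$ generate $R$ as a closed normal subgroup of $F$. Then $\ell_p(K)<\infty$ if and only if the matrix $$\begin{bmatrix} \mathrm{tr}_{\rho_1}\langle\chi_1,\chi_1,\chi_2\rangle&\mathrm{tr}_{\rho_1}\langle\chi_2,\chi_2,\chi_1\rangle\\ \mathrm{tr}_{\rho_2}\langle\chi_1,\chi_1,\chi_2\rangle&\mathrm{tr}_{\rho_2}\langle\chi_2,\chi_2,\chi_1\rangle \end{bmatrix}$$ is invertible over $\mathbb{F}_p$.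
   Context: Hilbert $p$-class field tower: for a number field $K$ and a prime $p$, set $K_p^{(0)}=K$ and, for $i\ge 1$, let $K_p^{(i)}$ be the Hilbert $p$-class field of $K_p^{(i-1)}$, i.e. its maximal unramified abelian $p$-extension. $K_p^{(\infty)}$ is the compositum of all the $K_p^{(i)}$. The $p$-length $\ell_p(K)$ is the least $i$ with $K_p^{(i)}=K_p^{(i+1)}$ if such an $i$ exists, and $\ell_p(K)=\infty$ otherwise. The pro-$p$-group $\mathrm{Gal}(K_p^{(\infty)}/K)$ is the $p$-tower group over $K$. The $p$-rank $d_p A$ of a finite abelian group $A$ is $\dim_{\mathbb{F}_p}A/pA$. Presentations: for a pro-$p$-group $G$ put $d(G)=\dim_{\mathbb{F}_p}H^1(G,\mathbb{F}_p)$ and $r(G)=\dim_{\mathbb{F}_p}H^2(G,\mathbb{F}_p)$ (continuous cohomology, trivial coefficients). A minimal presentation is an exact sequence $1\to R\to F\to G\to 1$ with $F$ a free pro-$p$-group on $d(G)$ generators; then $r(G)$ is the minimal number of generators of $R$ as a closed normal subgroup of $F$. It is a known theorem of Shafarevich that $r(G)=d(G)$ for $G$ a $p$-tower group over a quadratic imaginary field with $p$ odd; by the Burnside basis theorem $d(G)=d_p\mathrm{Cl}(K)$. So here $d(G)=r(G)=2$. Zassenhaus filtration: $F_n=\{g\in F: g-1\in I^n\}$, where $I$ is the augmentation ideal of the (completed) group ring of $F$ over $\mathbb{F}_p$; equivalently $F_n=\prod_{ip^j\ge n}\gamma_i(F)^{p^j}$ (closed subgroups), with $\gamma_i$ the lower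 central series. The level of $\rho\in R$ is the greatest $k$ with $\rho\in F_k$. Zassenhaus type: choose relations of maximal depth inductively. Let $R_1=\emptyset$ and, for $k\ge2$, let $R_k=R_{k-1}\cup\{\rho_{k,1},\dots,\rho_{k,r_k}\}$, where the $\rho_{k,i}\in R\cap F_k$ form a set of the least possible cardinality such that $R_k$ generates $RF_{k+1}/F_{k+1}$ as a normal subgroup of $F/F_{k+1}$. The numbers $r_k$ are invariants of $G$. When $d(G)=r(G)=2$, $G$ is of Zassenhaus type $(i,j)$ if the two relations so obtained have levels $i$ and $j$; in particular type $(3,3)$ means $r_3=2$ and $r_k=0$ for $k\ne 3$. Triple Massey products: for $p$ odd and $G$ a $p$-tower group over a quadratic imaginary field, it is a known fact that the cup product $H^1(G,\mathbb{F}_p)\times H^1(G,\mathbb{F}_p)\to H^2(G,\mathbb{F}_p)$ is zero. Hence for $i,j\in\{1,2\}$ one can write $\chi_i\cup\chi_j=d(f_{ij})$ for a continuous 1-cochain $f_{ij}:G\to\mathbb{F}_p$. Then $\langle\chi_i,\chi_j,\chi_k\rangle\in H^2(G,\mathbb{F}_p)$ is the class of the 2-cocycle $\chi_i\cup f_{jk}+f_{ij}\cup\chi_k$, which is independent of the choices of the $f_{ij}$. Trace maps: for a minimal presentation the transgression $\mathrm{tg}:H^1(R,\mathbb{F}_p)^G\to H^2(G,\mathbb{F}_p)$ in the inflation-restriction sequence is an isomorphism. For $\rho\in R$, the trace map $\mathrm{tr}_\rho:H^2(G,\mathbb{F}_p)\to\mathbb{F}_p$ is $\mathrm{tr}_\rho(\phi)=(\mathrm{tg}^{-1}\phi)(\rho)$.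 *)

(* Defs.v *)
From HB Require Import structures.
From mathcomp Require Import all_boot all_order all_algebra all_field.
From mathcomp Require Import finmap.
From mathcomp Require Import all_classical all_reals all_analysis.

Set Implicit Arguments.
Unset Strict Implicit.
Unset Printing Implicit Defensive.

Import GRing.Theory.

Local Open Scope classical_set_scope.
Local Open Scope ring_scope.

(** * Topological groups and pro-p-groups *)

HB.mixin Record Topological_isTopologicalGroup G & Group G & Topological G := {
  mulg_continuous : continuous (fun xy : G * G => (xy.1 * xy.2)%g);
  invg_continuous : continuous (fun x : G => (x^-1)%g)
}.

#[short(type="topologicalGroupType")]
HB.structure Definition TopologicalGroup :=
  {G of Topological_isTopologicalGroup G & Group G & Topological G}.

Section Groups.
Context {G : topologicalGroupType}.

Definition subgroup (A : set G) : Prop :=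
  [/\ A 1%g, forall x y, A x -> A y -> A (x * y)%g & forall x, A x -> A (x^-1)%g].

Definition normal_subgroup (A : set G) : Prop :=
  subgroup A /\ forall x g, A x -> A (x ^ g)%g.

Definition closed_subgroup_gen : set G -> set G :=
  smallest [set A | subgroup A /\ closed A].

Definition normal_subgroup_gen : set G -> set G := smallest normal_subgroup.

Definition closed_normal_subgroup_gen : set G -> set G :=
  smallest [set A | normal_subgroup A /\ closed A].

Definition cosets (U : set G) : set (set G) :=
  [set [set (g * u)%g | u in U] | g in [set: G]].

(* [lcs i] is the i-th term of the lower central series, indexed so that
   [lcs 1 = G]; the value at 0 is irrelevant. *)
Fixpoint lcs (i : nat) : set G :=
  match i with
  | i'.+1 => if i' == 0%N then [set: G] else
      closed_subgroup_gen
        [set z | exists x y : G, lcs i' x /\ z = [~ x, y]%g]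
  | 0 => [set: G]
  end.

(* The closed subgroup generated by all gamma_i(G)^(p^j) with i p^j >= n. *)
Definition zassenhaus (p n : nat) : set G :=
  closed_subgroup_gen
    [set z | exists (i j : nat) (x : G),
       [/\ (0 < i)%N, (n <= i * p ^ j)%N, lcs i x & z = (x ^+ (p ^ j))%g]].

End Groups.

Definition pro_p_group (p : nat) (G : topologicalGroupType) : Prop :=
  [/\ compact [set: G], hausdorff_space G, totally_disconnected [set: G]
    & forall U : set G, open U -> normal_subgroup U ->
        exists k : nat, (cosets U #= `I_(p ^ k))%card].

Definition continuous_hom (G H : topologicalGroupType) (f : G -> H) : Prop :=
  continuous f /\ {morph f : x y / (x * y)%g}.

Definition hom_ker (G H : topologicalGroupType) (f : G -> H) : set G :=
  [set x | f x = 1%g].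

Definition free_pro_p_group (p d : nat) (F : topologicalGroupType) : Prop :=
  pro_p_group p F /\
  exists x : 'I_d -> F,
    forall (P : topologicalGroupType), pro_p_group p P ->
    forall y : 'I_d -> P,
      exists! f : F -> P, continuous_hom f /\ forall i, f (x i) = y i.

(** * Continuous cohomology with coefficients in F_p (trivial action) *)

Section Cohomology.
Context (p : nat) {G : topologicalGroupType}.

(* Continuity for the discrete topology on F_p. *)
Definition cochain {T : topologicalType} (f : T -> 'F_p) : Prop :=
  forall a : 'F_p, open (f @^-1` [set a]).

Definition coboundary (f : G -> 'F_p) (s : G * G) : 'F_p :=
  f s.1 + f s.2 - f (s.1 * s.2)%g.

Definition cup (f g : G -> 'F_p) (s : G * G) : 'F_p := f s.1 * g s.2.

(* With trivial coefficients there are no nonzero 1-coboundaries. *)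
Definition H1 : set (G -> 'F_p) :=
  [set chi | cochain chi /\ forall x y, chi (x * y)%g = chi x + chi y].

Definition H1_basis (d : nat) (chi : 'I_d -> G -> 'F_p) : Prop :=
  (forall i, H1 (chi i)) /\
  forall psi, H1 psi ->
    exists! c : 'rV['F_p]_d, forall g, psi g = \sum_(i < d) c 0 i * chi i g.

Definition Z2 : set (G * G -> 'F_p) :=
  [set c | cochain c /\
     forall x y z, c (y, z) - c ((x * y)%g, z) + c (x, (y * z)%g) - c (x, y) = 0].

(* An element of H^2 is represented by the set of its cocycles. *)
Definition H2_class (c : G * G -> 'F_p) : set (G * G -> 'F_p) :=
  [set c' | exists2 b, cochain b & forall s, c' s = c s + coboundary b s].

(* The triple Massey product <chi_i, chi_j, chi_k> computed with cochains
   [f i j] such that [coboundary (f i j)] is [cup (chi i) (chi j)]. *)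
Definition massey (d : nat) (chi : 'I_d -> G -> 'F_p)
    (f : 'I_d -> 'I_d -> G -> 'F_p) (i j k : 'I_d) : set (G * G -> 'F_p) :=
  H2_class (fun s => cup (chi i) (f j k) s + cup (f i j) (chi k) s).

End Cohomology.

(** * Presentations *)

Section Presentations.
Context (p : nat) {F G : topologicalGroupType} (pi : F -> G).

Definition minimal_presentation (d : nat) : Prop :=
  [/\ free_pro_p_group p d F, continuous_hom pi, range pi = [set: G]
    & exists chi : 'I_d -> G -> 'F_p, H1_basis chi].

(* Elements of H^1(R, F_p)^G, with R the kernel of [pi]. A function on R is
   given by a function on F, of which only the restriction to R matters. *)
Definition H1_inv : set (F -> 'F_p) :=
  [set x | [/\ forall a : 'F_p, exists2 U : set F, open U &
                 hom_ker pi `&` x @^-1` [set a] = hom_ker pi `&` U,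
               forall r s, hom_ker pi r -> hom_ker pi s -> x (r * s)%g = x r + x s
             & forall r g, hom_ker pi r -> x (r ^ g)%g = x r]].

(* [transgression x phi] means tg(x) = phi: x extends to a continuous cochain
   on F whose coboundary is inflated from a cocycle in the class phi. *)
Definition transgression (x : F -> 'F_p) (phi : set (G * G -> 'F_p)) : Prop :=
  exists (y : F -> 'F_p) (c : G * G -> 'F_p),
    [/\ cochain y, forall r, hom_ker pi r -> y r = x r, Z2 c,
        forall s, coboundary y s = c (pi s.1, pi s.2) & phi = H2_class c].

(* tr_rho(phi) = (tg^-1 phi)(rho); the default value 0 is irrelevant when tg is
   bijective. *)
Definition trace_map (rho : F) (phi : set (G * G -> 'F_p)) : 'F_p :=
  xget 0 [set a | exists x, [/\ H1_inv x, transgression x phi & a = x rho]].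

(* The normal subgroup of F / F_(k+1) generated by the image of [A] is
   R F_(k+1) / F_(k+1); both are replaced by their preimages in F. *)
Definition generates_mod (k : nat) (A : set F) : Prop :=
  normal_subgroup_gen (A `|` zassenhaus p k.+1) =
  [set (r * f)%g | r in hom_ker pi & f in zassenhaus p k.+1].

Definition relations_upto (S : nat -> seq F) (k : nat) : set F :=
  [set r | exists m, [/\ (2 <= m)%N, (m <= k)%N & r \in S m]].

(* [S k] lists the relations rho_(k,1), ..., rho_(k,r_k). *)
Definition relations_of_maximal_depth (S : nat -> seq F) : Prop :=
  forall k, (2 <= k)%N ->
    [/\ forall r, r \in S k -> hom_ker pi r /\ zassenhaus p k r,
        generates_mod k (relations_upto S k)
      & forall s : seq F,
          (forall r, r \in s -> hom_ker pi r /\ zassenhaus p k r) ->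
          generates_mod k (relations_upto S k.-1 `|` [set r | r \in s]) ->
          (size (S k) <= size s)%N].

End Presentations.

(* By minimality the relations in [S k] have level exactly k, so the type is
   (i, j) when r_k is the multiplicity of k in the pair (i, j). *)
Definition zassenhaus_type (p : nat) (G : topologicalGroupType) (i j : nat) :
    Prop :=
  exists (F : topologicalGroupType) (pi : F -> G) (S : nat -> seq F),
    [/\ minimal_presentation p pi 2, relations_of_maximal_depth p pi S
      & forall k, (2 <= k)%N -> size (S k) = ((k == i) + (k == j))%N].

(** * Subfields of the algebraic numbers *)

Record algC_subfield := AlgCSubfield {
  algC_subfield_pred :> {pred algC};
  algC_subfieldP : divring_closed algC_subfield_pred
}.

HB.instance Definition _ (E : algC_subfield) :=
  GRing.isDivringClosed.Build algC (algC_subfield_pred E) (algC_subfieldP E).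

Record elt (E : algC_subfield) := Elt { elt_val :> algC; eltP : elt_val \in E }.

Section SubfieldElements.
Variable E : algC_subfield.
HB.instance Definition _ := [isSub for @elt_val E].
HB.instance Definition _ := [Countable of elt E by <:].
HB.instance Definition _ := [SubChoice_isSubIntegralDomain of elt E by <:].
HB.instance Definition _ := [SubIntegralDomain_isSubField of elt E by <:].
HB.instance Definition _ := isPointed.Build (elt E) 0.
End SubfieldElements.

Definition rationals : algC_subfield := AlgCSubfield Crat_divring_closed.

Lemma compositum_divring_closed (T : nat -> algC_subfield) :
  divring_closed (fun x : algC =>
    `[< forall M : algC_subfield, (forall i, {subset T i <= M}) -> x \in M >]).
Proof.
split=> [|x y /asboolP hx /asboolP hy|x y /asboolP hx /asboolP hy];
  apply/asboolP => M hM.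
- exact: rpred1.
- by apply: rpredB; [exact: hx | exact: hy].
- by apply: rpred_div; [exact: hx | exact: hy].
Qed.

Definition compositum (T : nat -> algC_subfield) : algC_subfield :=
  AlgCSubfield (compositum_divring_closed T).

(* [E : L] = n *)
Definition degree (L E : algC_subfield) (n : nat) : Prop :=
  {subset L <= E} /\
  exists b : 'I_n -> elt E,
    forall x : elt E, exists! c : {ffun 'I_n -> elt L},
      elt_val x = \sum_(i < n) elt_val (c i) * elt_val (b i).

(** ** Galois groups with the Krull topology *)

Definition automorphism_over (L E : algC_subfield) (s : elt E -> elt E) : Prop :=
  [/\ {morph s : x y / x + y}, {morph s : x y / x * y}, bijective s
    & forall x, elt_val x \in L -> s x = x].

Record galois_group (L E : algC_subfield) := Gal {
  gal_fun :> elt E -> elt E;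
  galP : automorphism_over L gal_fun
}.

Section GaloisGroup.
Variables L E : algC_subfield.
Implicit Types s t u : galois_group L E.

Lemma gal_eq s t : s =1 t -> s = t.
Proof.
case: s t => [s hs] [t ht] /= /funext est.
by subst t; congr Gal; exact: Prop_irrelevance.
Qed.

HB.instance Definition _ := gen_eqMixin (galois_group L E).
HB.instance Definition _ := gen_choiceMixin (galois_group L E).

Lemma gal_id_subproof : automorphism_over L (@id (elt E)).
Proof. by split=> //; exists id. Qed.

Definition gal_id : galois_group L E := Gal gal_id_subproof.

Lemma gal_comp_subproof s t : automorphism_over L (s \o t).
Proof.
have [sD sM sB sL] := galP s; have [tD tM tB tL] := galP t.
split=> [x y|x y||x xL] /=; first by rewrite tD sD.
- by rewrite tM sM.
- exact: bij_comp.
- by rewrite tL // sL.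
Qed.

Definition gal_comp s t : galois_group L E := Gal (gal_comp_subproof s t).

Lemma gal_inv_exists s : exists t, cancel s t /\ cancel t s.
Proof.
have [sD sM [t st ts] sL] := galP s.
suff tP : automorphism_over L t by exists (Gal tP).
split=> [x y|x y||x xL].
- by rewrite -{1}(ts x) -{1}(ts y) -sD st.
- by rewrite -{1}(ts x) -{1}(ts y) -sM st.
- by exists s.
- by rewrite -{1}(sL x xL) st.
Qed.

Definition gal_inv s : galois_group L E := projT1 (cid (gal_inv_exists s)).

Lemma gal_invK s : cancel s (gal_inv s) /\ cancel (gal_inv s) s.
Proof. exact: (projT2 (cid (gal_inv_exists s))). Qed.

Lemma gal_compA : associative gal_comp.
Proof. by move=> s t u; exact: gal_eq. Qed.
Lemma gal_comp1 : left_id gal_id gal_comp.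
Proof. by move=> s; exact: gal_eq. Qed.
Lemma gal_1comp : right_id gal_id gal_comp.
Proof. by move=> s; exact: gal_eq. Qed.
Lemma gal_compV : left_inverse gal_id gal_inv gal_comp.
Proof. by move=> s; apply: gal_eq => x /=; have [-> _] := gal_invK s. Qed.
Lemma gal_Vcomp : right_inverse gal_id gal_inv gal_comp.
Proof. by move=> s; apply: gal_eq => x /=; have [_ ->] := gal_invK s. Qed.

HB.instance Definition _ := isGroup.Build (galois_group L E)
  gal_compA gal_comp1 gal_1comp gal_compV gal_Vcomp.

(* Krull topology: the sets [s x = y] form a subbase of open sets. *)
HB.instance Definition _ := isSubBaseTopological.Build (galois_group L E)
  [set: elt E * elt E] (fun xy => [set s : galois_group L E | s xy.1 = xy.2]).

End GaloisGroup.

Section KrullTopologicalGroup.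
Variables L E : algC_subfield.

Lemma open_gal_subbase (x y : elt E) : open [set s : galois_group L E | s x = y].
Proof.
exists [set [set s : galois_group L E | s x = y]]; last by rewrite bigcup_set1.
move=> _ ->; exists [fset (x, y)]%fset; first by move=> i _; rewrite inE.
apply/seteqP; split=> [s /(_ (x, y))|s sxy i /=]; last first.
  by rewrite inE => /eqP ->.
by rewrite /= inE; apply.
Qed.

Lemma cvg_gal (T : Type) (F : set_system T) (f : T -> galois_group L E) (s : galois_group L E) :
  Filter F -> (forall x, \forall t \near F, f t x = s x) -> f @ F --> s.
Proof.
move=> FF fs A /=; rewrite nbhsE => -[B [[D sD <-] [I DI Is]] sBA].
have [J _ IJ] := sD I DI.
suff : F (f @^-1` I) by apply: filterS => t ft; apply: sBA; exists I.
rewrite -IJ in Is; rewrite -IJ; apply: filter_bigI => i iJ.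
by apply: filterS (fs i.1) => t /= ->; exact: (Is i iJ).
Qed.

Lemma gal_mul_continuous :
  continuous (fun st : galois_group L E * galois_group L E => (st.1 * st.2)%g).
Proof.
move=> [s t]; apply: (@cvg_gal _ (nbhs (s, t))) => x /=.
exists ([set u : galois_group L E | u (t x) = s (t x)], [set u : galois_group L E | u x = t x]).
  by split; apply: open_nbhs_nbhs; split => //; exact: open_gal_subbase.
by move=> [u v] [/= ust vt]; rewrite vt ust.
Qed.

Lemma gal_inv_continuous : continuous (fun s : galois_group L E => (s^-1)%g).
Proof.
move=> s; apply: (@cvg_gal _ (nbhs s)) => x /=.
have : nbhs s [set u : galois_group L E | u ((s^-1)%g x) = x].
  apply: open_nbhs_nbhs; split; first exact: open_gal_subbase.
  by have [_ sK] := gal_invK s; exact: sK.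
apply: filterS => u /= ux.
by have [uK _] := gal_invK u; rewrite -{1}ux; exact: uK.
Qed.

HB.instance Definition _ := Topological_isTopologicalGroup.Build (galois_group L E)
  gal_mul_continuous gal_inv_continuous.

End KrullTopologicalGroup.

(* Only used for extensions of finite degree. *)
Definition galois_extension (L E : algC_subfield) : Prop :=
  {subset L <= E} /\
  forall x : elt E, (forall s : galois_group L E, s x = x) -> elt_val x \in L.

(** ** Ideals of rings of integers *)

Definition integers (L : algC_subfield) : set algC :=
  [set x | x \in L /\ x \in Aint].

Definition ideal (L : algC_subfield) (I : set algC) : Prop :=
  [/\ I `<=` integers L, I 0, forall x y, I x -> I y -> I (x + y)
    & forall a x, integers L a -> I x -> I (a * x)].

Definition nonzero_ideal (L : algC_subfield) (I : set algC) : Prop :=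
  ideal L I /\ exists2 x, I x & x != 0.

Definition nonzero_prime_ideal (L : algC_subfield) (P : set algC) : Prop :=
  [/\ nonzero_ideal L P, ~ P 1
    & forall x y, integers L x -> integers L y -> P (x * y) -> P x \/ P y].

Definition ideal_mul (I J : set algC) : set algC :=
  [set x | exists (n : nat) (a b : 'I_n -> algC),
     [/\ forall i, I (a i), forall i, J (b i) & x = \sum_(i < n) a i * b i]].

Definition ideal_pow (L : algC_subfield) (I : set algC) (n : nat) : set algC :=
  iter n (ideal_mul I) (integers L).

(* I and J define the same class in Cl(L). *)
Definition ideal_equiv (L : algC_subfield) (I J : set algC) : Prop :=
  exists a b : algC,
    [/\ integers L a, integers L b, a != 0, b != 0
      & [set a * x | x in I] = [set b * x | x in J]].

(* dim_{F_p} Cl(L)/p Cl(L) = r: the classes of some ideals C_1, ..., C_r form a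
   basis, i.e. modulo p-th powers every ideal class is a product of powers of
   the C_i with unique exponents in F_p. *)
Definition class_group_prank (p : nat) (L : algC_subfield) (r : nat) : Prop :=
  exists C : 'I_r -> set algC,
    (forall i, nonzero_ideal L (C i)) /\
    forall J, nonzero_ideal L J ->
      exists! e : 'rV['F_p]_r, exists2 A, nonzero_ideal L A &
        ideal_equiv L J
          (ideal_mul
             (\big[ideal_mul/integers L]_(i < r) ideal_pow L (C i) (e 0 i))
             (ideal_pow L A p)).

(** ** Hilbert p-class field tower *)

(* At a nonzero prime P of E the ramification index is the largest e such that
   P^e contains the prime of L below P; the residue fields are finite, so there
   is no separability condition. At the infinite places, no real embedding of L
   extends to a non-real embedding of E. *)
Definition unramified (L E : algC_subfield) : Prop :=
  (forall P, nonzero_prime_ideal E P ->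
     ~ (P `&` integers L `<=` ideal_pow E P 2)) /\
  (forall f : {rmorphism elt E -> algC},
     (forall x : elt E, elt_val x \in L -> f x \is Num.real) ->
     forall x, f x \is Num.real).

Definition unramified_abelian_p_extension (p : nat) (L E : algC_subfield) :
    Prop :=
  [/\ exists k : nat, degree L E (p ^ k), galois_extension L E,
      forall s t : galois_group L E, (s * t)%g = (t * s)%g & unramified L E].

Definition hilbert_p_class_field (p : nat) (L H : algC_subfield) : Prop :=
  unramified_abelian_p_extension p L H /\
  forall M, unramified_abelian_p_extension p L M -> {subset M <= H}.

Definition p_class_field_tower (p : nat) (K : algC_subfield)
    (T : nat -> algC_subfield) : Prop :=
  T 0 =i K /\ forall i, hilbert_p_class_field p (T i) (T i.+1).

(* l_p(K) < oo *)
Definition finite_p_length (T : nat -> algC_subfield) : Prop :=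
  exists i, T i =i T i.+1.

(* For [T] the p-class field tower of [K]. *)
Definition tower_group (K : algC_subfield) (T : nat -> algC_subfield) :
    topologicalGroupType := galois_group K (compositum T).

Definition quadratic_imaginary (K : algC_subfield) : Prop :=
  degree rationals K 2 /\
  forall f : {rmorphism elt K -> algC}, exists x, f x \isn't Num.real.

Definition conjecture_33 : Prop :=
  forall (q : nat) (L : algC_subfield) (T : nat -> algC_subfield),
    prime q -> odd q -> quadratic_imaginary L -> class_group_prank q L 2 ->
    p_class_field_tower q L T ->
    (finite_set [set: tower_group L T] <->
     zassenhaus_type q (tower_group L T) 3 3).

(* Main.v *)
(** The tower is finite exactly when [G] is: any automorphism of [algC] over [K]
    preserves each [T i] by maximality of Hilbert class fields, so an infinite
    strictly increasing tower gives infinitely many elements of [G].  By the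
    conjecture it remains to decide when [G] has Zassenhaus type (3,3).

    Freeness of [F] yields a homomorphism [mu] from [F] to the units of the
    truncated noncommutative power series ring F_p<<X_0, X_1>>/(X_0, X_1)^4 with
    linear part given by the [chi i].  Since cup products vanish, the quadratic
    coefficients of [mu] vanish on the relations, which therefore lie in [F_3], and
    the cubic coefficient at [X_i X_j X_k] computes the trace of the Massey
    product <chi_i, chi_j, chi_k>.  As p > 3, [F_n] is the product of the [n]-th
    term of the lower central series and the p-th powers for n <= 4, so that
    F_3/F_4 is spanned by two basic commutators, and the coefficients at
    X_0 X_0 X_1 and X_1 X_1 X_0 identify it with F_p^2.  The matrix is then
    invertible if and only if the relations fill F_3/F_4, that is, if and only if
    the type is (3,3); all [F_n] being open, the two relations suffice modulo every
    deeper term. *)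

Require Import Defs.
From HB Require Import structures.
From mathcomp Require Import all_boot all_order all_algebra all_fingroup all_solvable all_field.
From mathcomp Require Import all_classical all_reals all_analysis.
From mathcomp Require Import ring.

Set Implicit Arguments.
Unset Strict Implicit.
Unset Printing Implicit Defensive.

Import GRing.Theory.

Local Open Scope classical_set_scope.
Local Open Scope ring_scope.

(** * Profinite groups *)

(** [zassenhaus_type] asks for some minimal presentation, whereas the matrix belongs to the given
    one. The bridge is a statement on $G$ alone: a combination of the two Massey products whose
    traces vanish on all relations is a coboundary on $G$, and then the relations of any minimal
    presentation span at most a line in $F_3/F_4$.

    The bound $p>3$ enters twice: $\binom p2$ and $\binom p3$ vanish modulo $p$, so the truncated
    Magnus group has exponent $p$; and $4\le p$ puts all $p$-th powers into $F_4$.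

    The free generators of $F$ need not be dual to [chi]. A dual pair [y] is built from them and
    shown to generate $F$ topologically by a Frattini argument; this is all that the computation of
    $F_3/F_4$ requires. Freeness itself is tested only on finite $p$-groups.

    Quotients of $F$ are mostly avoided: generation modulo a term of a filtration is expressed by
    closed subgroups containing that term, and elements of a layer are written as products of powers
    with bounded exponents. *)

Section Profinite.
Context {T : topologicalType}.
Hypothesis cptT : compact [set: T].

(** The clopen sets containing [x] are stable under finite intersection, and their complements cover
    the compact complement of [U]; one of them therefore lies inside [U]. *)
Lemma quasi_component_clopen (x : T) (U : set T) : open U ->
    (forall y, (forall D, clopen D -> D x -> D y) -> U y) ->
  exists D, [/\ clopen D, D x & D `<=` U].
Proof.
move=> oU QU.
pose Fx := filter_from [set D : set T | D x /\ clopen D] id.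
have FF : Filter Fx.
  apply: filter_from_filter; first by exists setT; split => //; exact: clopenT.
  by move=> A B [? ?] [? ?]; exists (A `&` B) => //; split=> //; exact: clopenI.
have PF : ProperFilter Fx by apply: filter_from_proper; move=> ? [? _]; exists x.
suff [D [Dx cD] DU] : Fx U by exists D.
have /(iffLR (compact_near_coveringP _)) : compact (~` U).
  by apply: (subclosed_compact _ cptT) => //; exact: open_closedC.
move=> /(_ _ _ setC (powerset_filter_from_filter PF))[].
  move=> y nUy.
  have [C [[oC cC] Cx Cy]] : exists C, [/\ clopen C, C x & ~ C y].
    apply: contrapT => nC; apply: nUy; apply: QU => D cD Dx.
    by apply: contrapT => nDy; apply: nC; exists D.
  exists (~` C, [set U | U `<=` C]); first split.
  - by apply: open_nbhs_nbhs; split => //; exact: closed_openC.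
  - apply/near_powerset_filter_fromP; first by move=> ? ?; exact: subset_trans.
    by exists C => //; exists C.
  - by case=> i j [? /subsetC]; apply.
by move=> D [DF _ [C DC]]/(_ _ DC)/subsetC2/filterS; apply; exact: DF.
Qed.

(** Two disjoint closed pieces of the quasi-component are separated by disjoint open sets [W] and
    [V], by normality. A clopen [D] inside their union is cut by [W] into a clopen set containing
    [x], which leaves no room for the second piece. *)
Lemma quasi_component_connected (x : T) : hausdorff_space T ->
  connected [set y : T | forall D, clopen D -> D x -> D y].
Proof.
move=> hT; set Q := [set y | _].
have cQ : closed Q.
  rewrite (_ : Q = \bigcap_(D in [set D : set T | clopen D /\ D x]) D).
    by apply: closed_bigI => D [[]].
  by apply/seteqP; split=> [y Qy D [cD Dx]|y Qy D cD Dx]; apply: Qy.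
have separate (A B : set T) : closed A -> closed B -> A `&` B = set0 ->
    A `|` B = Q -> A x -> B = set0.
  move=> cA cB AB0 ABQ Ax.
  have nA : set_nbhs A (~` B).
    apply/set_nbhsP; exists (~` B); split => //; first exact: closed_openC.
    exact/disjoints_subset.
  have [C /set_nbhsP [W [oW AW WC]] CB] := compact_normal hT cptT cA nA.
  pose V := ~` closure C.
  have oV : open V by apply: closed_openC; exact: closed_closure.
  have WV0 y : W y -> V y -> False.
    by move=> Wy; apply; apply: subset_closure; exact: WC.
  have [|y Qy|D [[oD cD] Dx DWV]] := @quasi_component_clopen x (W `|` V).
  - exact: openU.
  - have : (A `|` B) y by rewrite ABQ.
    by case=> [/AW|By]; [left|right => /CB].
  - rewrite -subset0 => y By.
    have : (D `&` W) y.
      have Qy : Q y by rewrite -ABQ; right.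
      apply: Qy; last by split => //; exact: AW.
      split; first exact: openI.
      rewrite (_ : D `&` W = D `&` ~` V).
        by apply: closedI => //; exact: open_closedC.
      apply/seteqP; split=> z [Dz]; first by move=> Wz; split=> // /(WV0 _ Wz).
      by move=> nVz; split=> //; case: (DWV _ Dz).
    by move=> [_ Wy]; apply: (WV0 _ Wy) => /CB.
move=> B [b Bb] [C oC BQC] [D cD BQD].
have Qx : Q x by [].
have cB : closed B by rewrite BQD; exact: closedI.
have cB' : closed (Q `&` ~` C) by apply: closedI => //; exact: open_closedC.
have BB'0 : B `&` (Q `&` ~` C) = set0.
  by rewrite BQC -subset0 => y [[_ ?] [_]].
have BB'Q : B `|` (Q `&` ~` C) = Q by rewrite BQC -setIUr setUv setIT.
have [Bx|nBx] := pselect (B x).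
  by rewrite -[RHS]BB'Q (separate _ _ cB cB' BB'0 BB'Q Bx) setU0.
have B0 : B = set0.
  apply: (separate _ _ cB' cB); [by rewrite setIC|by rewrite setUC|].
  by split=> // Cx; apply: nBx; rewrite BQC.
by move: Bb; rewrite B0.
Qed.

Lemma clopen_nbhs_basis (x : T) (U : set T) : hausdorff_space T ->
    totally_disconnected [set: T] -> nbhs x U ->
  exists D, [/\ clopen D, D x & D `<=` U].
Proof.
move=> hT tdT; rewrite nbhsE => -[W [oW Wx] WU].
have [|D [cD Dx DW]] := @quasi_component_clopen x W oW.
  move=> y Qy.
  have : connected_component [set: T] x y.
    exists [set y : T | forall D, clopen D -> D x -> D y] => //.
    by split => //; exact: quasi_component_connected.
  by rewrite tdT // => ->.
by exists D; split => //; exact: subset_trans WU.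
Qed.

End Profinite.

(** * Small open normal subgroups *)

Lemma mulg_continuous_fun (T : topologicalType) (G : topologicalGroupType) (f g : T -> G) :
  continuous f -> continuous g -> continuous (fun x => (f x * g x)%g).
Proof.
move=> cf cg x; apply: (@continuous2_cvg _ _ _ _ (nbhs x) _ f g (fun a b => (a * b)%g) _ _ _ (cf x) (cg x)).
exact: (mulg_continuous (f x, g x)).
Qed.

Lemma conjg_continuous_fun (T : topologicalType) (G : topologicalGroupType) (f g : T -> G) :
  continuous f -> continuous g -> continuous (fun x => (f x ^ g x)%g).
Proof.
move=> cf cg; apply: mulg_continuous_fun; last exact: mulg_continuous_fun.
by move=> x; apply: continuous_comp; [exact: cg|exact: invg_continuous].
Qed.

Lemma cst_continuous_fun (T U : topologicalType) (a : U) : continuous (fun _ : T => a).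
Proof. by move=> x; exact: cvg_cst. Qed.

Section TopGroups.
Context {G : topologicalGroupType}.

Lemma open_normal_basis (U : set G) :
    compact [set: G] -> hausdorff_space G -> totally_disconnected [set: G] ->
    nbhs 1%g U ->
  exists V, [/\ open V, normal_subgroup V & V `<=` U].
Proof.
move=> cG hG tG /(clopen_nbhs_basis cG hG tG) [C [[oC cC] C1 CU]].
(* the stabiliser of [C] under two-sided translations *)
pose V := [set x : G | forall g h, C (g * x * h)%g <-> C (g * h)%g].
have sV : subgroup V.
  split=> [g h|x y Vx Vy g h|x Vx g h]; first by rewrite mulg1.
  - by rewrite mulgA (Vy (g * x)%g h); exact: Vx.
  - by rewrite -(Vx (g * x^-1)%g h) mulgVK.
exists V; split.
- have cGG : compact [set: G * G].
    by rewrite -setXTT; exact: compact_setX.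
  rewrite openE => x Vx; rewrite /interior /=.
  (* Compactness of $G\times G$ turns neighbourhoods of [x] depending on [(g, h)] into a single one,
     which makes [V] open. *)
  have cov := iffLR (compact_near_coveringP _) cGG G (nbhs x)
    (fun z gh => C (gh.1 * z * gh.2)%g <-> C (gh.1 * gh.2)%g) _.
  suff /cov : forall gh : G * G, [set: G * G] gh ->
      \forall gh' \near gh & z \near x, C (gh'.1 * z * gh'.2)%g <-> C (gh'.1 * gh'.2)%g.
    by apply: filterS => z Cz g h; exact: (Cz (g, h) I).
  {
    move=> [g h] _ /=.
    have cont3 : continuous (fun t : (G * G) * G => (t.1.1 * t.2 * t.1.2)%g).
      apply: mulg_continuous_fun; first apply: mulg_continuous_fun.
      - by move=> t; apply: (@continuous_comp _ _ _ fst fst); exact: cvg_fst.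
      - by move=> t; exact: cvg_snd.
      - by move=> t; apply: (@continuous_comp _ _ _ fst snd); [exact: cvg_fst|exact: cvg_snd].
    have cont2 : continuous (fun t : (G * G) * G => (t.1.1 * t.1.2)%g).
      apply: mulg_continuous_fun => t; apply: (@continuous_comp _ _ _ fst) => //;
        by [exact: cvg_fst|exact: cvg_snd].
    have near2 A : open A -> A (g * h)%g -> A (g * x * h)%g ->
      \forall t \near ((g, h), x), A (t.1.1 * t.2 * t.1.2)%g /\ A (t.1.1 * t.1.2)%g.
      move=> oA A2 A3; near=> t; split; near: t.
        by apply: (cont3 (g, h, x)); exact: open_nbhs_nbhs.
      by apply: (cont2 (g, h, x)); exact: open_nbhs_nbhs.
    have [Cgh|nCgh] := pselect (C (g * h)%g).
      by apply: filterS (near2 C oC Cgh _) => [t []//|]; exact/Vx.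
    apply: filterS (near2 (~` C) _ nCgh _) => [t []//||]; first exact: closed_openC.
    by move=> /Vx.
  }
- split=> // x g Vx a b.
  rewrite conjgE !mulgA -[in X in C X](mulgA _ g b).
  by rewrite (Vx (a * g^-1)%g (g * b)%g) -!mulgA mulKg.
- by move=> x /(_ 1%g 1%g); rewrite !(mulg1, mul1g) => -[_ /(_ C1)/CU].
Unshelve. all: by end_near. Qed.

End TopGroups.

Lemma closed_preimage (T U : topologicalType) (f : T -> U) (A : set U) :
  continuous f -> closed A -> closed [set x | A (f x)].
Proof. by move=> /continuous_closedP cf /cf. Qed.

Lemma open_preimage (T U : topologicalType) (f : T -> U) (A : set U) :
  continuous f -> open A -> open [set x | A (f x)].
Proof. by move=> /continuousP cf /cf. Qed.

Lemma id_continuous_fun (T : topologicalType) : continuous (fun x : T => x).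
Proof. by move=> x; exact: cvg_id. Qed.

(** * Closed subgroups and the two filtrations *)

Section Subgroups.
Context {G : topologicalGroupType}.
Implicit Types (A B S : set G) (x y g : G).

Lemma subgroupX A x n : subgroup A -> A x -> A (x ^+ n)%g.
Proof.
move=> [A1 AM _] Ax; elim: n => [//|n IHn].
by rewrite expgS; exact: AM.
Qed.

Lemma subgroupJ A x g : subgroup A -> A x -> A [~ x, g]%g -> A (x ^ g)%g.
Proof. by move=> [_ AM _] Ax; rewrite commgEl => /(AM _ _ Ax); rewrite mulVKg. Qed.

Lemma closed_subgroup_gen_sub S : S `<=` closed_subgroup_gen S.
Proof. exact: sub_gen_smallest. Qed.

Lemma closed_subgroup_gen_min S A : subgroup A -> closed A -> S `<=` A ->
  closed_subgroup_gen S `<=` A.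
Proof. by move=> sA cA SA; apply: smallest_sub. Qed.

Lemma closed_subgroup_gen_subgroup S : subgroup (closed_subgroup_gen S).
Proof.
split=> [A [[[]]] //|x y Sx Sy A|x Sx A] /[dup] ? [[[_ AM AV] _] _].
  by apply: AM; [exact: Sx|exact: Sy].
by apply: AV; exact: Sx.
Qed.

Lemma closed_subgroup_gen_closed S : closed (closed_subgroup_gen S).
Proof. by apply: closed_bigI => A [[]]. Qed.

Lemma closed_subgroup_gen_normal S : (forall x g, S x -> S (x ^ g)%g) ->
  normal_subgroup (closed_subgroup_gen S).
Proof.
move=> SJ; have sS := closed_subgroup_gen_subgroup S.
split=> // x g Sx; have [S1 SM SV] := sS.
apply: (closed_subgroup_gen_min (A := [set y | closed_subgroup_gen S (y ^ g)%g])) Sx.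
- split=> /= [|y z|y]; first by rewrite conj1g.
  + by rewrite conjMg; exact: SM.
  + by rewrite conjVg; exact: SV.
- apply: (@closed_preimage _ _ (fun y => y ^ g)%g); last exact: closed_subgroup_gen_closed.
  by apply: conjg_continuous_fun; [exact: id_continuous_fun|exact: cst_continuous_fun].
- by move=> y Sy; apply: closed_subgroup_gen_sub; exact: SJ.
Qed.

Lemma open_subgroup_invariant A B : subgroup A -> open A ->
  (forall x a, B x -> A a -> B (x * a)%g) -> open B.
Proof.
move=> [A1 _ AV] oA BA.
rewrite (_ : B = \bigcup_(b in B) [set x | A (b^-1 * x)%g]).
  apply: bigcup_open => b _; apply: (@open_preimage _ _ (fun x => b^-1 * x)%g) => //.
  by apply: mulg_continuous_fun; [exact: cst_continuous_fun|exact: id_continuous_fun].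
apply/seteqP; split=> [x Bx|x [b Bb] /(BA _ _ Bb)]; last by rewrite mulVKg.
by exists x => //=; rewrite mulVg.
Qed.

Lemma open_subgroup_sub A B : subgroup A -> open A -> subgroup B -> A `<=` B -> open B.
Proof.
by move=> sA oA [_ BM _] AB; apply: (open_subgroup_invariant sA oA) => x a Bx /AB; exact: BM.
Qed.

Lemma open_subgroup_closed A : subgroup A -> open A -> closed A.
Proof.
move=> sA oA; rewrite -[A]setCK; apply: open_closedC.
apply: (open_subgroup_invariant sA oA) => x a nAx Aa Axa; apply: nAx.
have [_ AM AV] := sA.
by rewrite -(mulgK a x); apply: AM => //; exact: AV.
Qed.

Lemma lcsS i : (0 < i)%N ->
  lcs i.+1 = closed_subgroup_gen [set z : G | exists x y, lcs i x /\ z = [~ x, y]%g].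
Proof. by case: i. Qed.

Lemma lcs_closed i : closed (lcs i : set G).
Proof. by case: i => [|[|i]]; do ?[exact: closedT|exact: closed_subgroup_gen_closed]. Qed.

Lemma lcs_normal i : normal_subgroup (lcs i : set G).
Proof.
elim: i => [|[|i] IHi]; [by split; [split|] | by split; [split|] |].
rewrite lcsS //; apply: closed_subgroup_gen_normal => _ g [x [y [ix ->]]].
exists (x ^ g)%g, (y ^ g)%g; split; last by rewrite conjRg.
exact: (IHi.2).
Qed.

Lemma lcsR i x y : (0 < i)%N -> lcs i x -> lcs i.+1 [~ x, y]%g.
Proof.
by move=> i0 ix; rewrite lcsS //; apply: closed_subgroup_gen_sub; exists x, y.
Qed.

Variable p : nat.

Lemma zassenhaus_closed n : closed (zassenhaus p n : set G).
Proof. exact: closed_subgroup_gen_closed. Qed.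

Lemma zassenhaus_normal n : normal_subgroup (zassenhaus p n : set G).
Proof.
apply: closed_subgroup_gen_normal => _ g [i [j [x [i0 nij ix ->]]]].
exists i, j, (x ^ g)%g; split=> //; last by rewrite conjXg.
exact: (lcs_normal i).2.
Qed.

Lemma zassenhausS m n : (m <= n)%N -> zassenhaus p n `<=` (zassenhaus p m : set G).
Proof.
move=> mn; apply: closed_subgroup_gen_min.
- exact: (zassenhaus_normal m).1.
- exact: zassenhaus_closed.
- move=> _ [i [j [x [i0 nij ix ->]]]]; apply: closed_subgroup_gen_sub.
  by exists i, j, x; split=> //; exact: leq_trans nij.
Qed.

Lemma zassenhaus_lcs n : (0 < n)%N -> lcs n `<=` (zassenhaus p n : set G).
Proof.
move=> n0 x nx; apply: closed_subgroup_gen_sub; exists n, 0%N, x.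
by split; rewrite ?expn0 ?muln1 ?expg1.
Qed.

Lemma zassenhausX n j x : (n <= p ^ j)%N -> zassenhaus p n (x ^+ (p ^ j))%g.
Proof.
move=> npj; apply: closed_subgroup_gen_sub; exists 1%N, j, x.
by split; rewrite ?mul1n.
Qed.

End Subgroups.

(** * Finite quotients and the Frattini criterion *)

Record finite_quotient (G : groupType) := FiniteQuotient {
  quot_index : nat;
  quot_proj : G -> 'I_quot_index;
  quot_repr : 'I_quot_index -> G;
  quot_reprK : cancel quot_repr quot_proj;
  quot_congr : forall x x' y y', quot_proj x = quot_proj x' ->
    quot_proj y = quot_proj y' -> quot_proj (x * y)%g = quot_proj (x' * y')%g
}.

Section FiniteQuotientGroup.
Variables (G : groupType) (q : finite_quotient G).

Definition quotient_type := 'I_(quot_index q).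
HB.instance Definition _ := Finite.copy quotient_type (ordinal (quot_index q)).

Let proj : G -> quotient_type := quot_proj q.
Let repr : quotient_type -> G := quot_repr (f := q).

Definition quotient_mul (i j : quotient_type) := proj (repr i * repr j)%g.
Definition quotient_inv (i : quotient_type) := proj (repr i)^-1%g.

Lemma quotient_mulE x y : quotient_mul (proj x) (proj y) = proj (x * y)%g.
Proof. by apply: quot_congr; exact: quot_reprK. Qed.

Lemma quotient_projP (i : quotient_type) : exists x, i = proj x.
Proof. by exists (repr i); rewrite /proj quot_reprK. Qed.

Lemma quotient_mulA : associative quotient_mul.
Proof.
move=> i j k; have [x ->] := quotient_projP i; have [y ->] := quotient_projP j.
by have [z ->] := quotient_projP k; rewrite !quotient_mulE mulgA.
Qed.

Lemma quotient_mul1 : left_id (proj 1%g) quotient_mul.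
Proof. by move=> i; have [x ->] := quotient_projP i; rewrite quotient_mulE mul1g. Qed.

Lemma quotient_mulV : left_inverse (proj 1%g) quotient_inv quotient_mul.
Proof.
move=> i; rewrite -[in X in quotient_mul _ X](quot_reprK i).
by rewrite -/(proj _) quotient_mulE mulVg.
Qed.

HB.instance Definition _ := Finite_isGroup.Build quotient_type
  quotient_mulA quotient_mul1 quotient_mulV.

Definition to_quotient (x : G) : quotient_type := proj x.

Lemma to_quotientM : {morph to_quotient : x y / (x * y)%g}.
Proof. by move=> x y; rewrite -[RHS]/(quotient_mul _ _) quotient_mulE. Qed.

Lemma to_quotient_surj (i : quotient_type) : exists x, to_quotient x = i.
Proof. by have [x ->] := quotient_projP i; exists x. Qed.

End FiniteQuotientGroup.

(** The pro-$p$ condition only counts cosets, so the bijection with an initial segment of the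
    naturals is what makes $G/V$ a finite group on ordinals, with a chosen section. *)
Lemma finite_quotient_exists (G : topologicalGroupType) (V : set G) (n : nat) :
    normal_subgroup V -> (cosets V #= `I_n)%card ->
  exists q : finite_quotient G, quot_index q = n /\
    forall x y, quot_proj q x = quot_proj q y <-> V (x^-1 * y)%g.
Proof.
move=> [[V1 VM VV] VJ] /card_set_bijP [f [ffun finj fsurj]].
pose coset x : set G := [set (x * u)%g | u in V].
have cosetE x y : coset x = coset y <-> V (x^-1 * y)%g.
  split=> [xy|Vxy].
    have [u Vu <-] : coset x y by rewrite xy; exists 1%g; rewrite ?mulg1.
    by rewrite mulKg.
  apply/seteqP; split=> _ [u Vu <-].
    exists ((x^-1 * y)^-1 * u)%g; first by apply: VM => //; exact: VV.
    by rewrite invgM invgK !mulgA mulgV mul1g.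
  by exists ((x^-1 * y) * u)%g; [exact: VM | rewrite !mulgA mulgV mul1g].
have fP x : (f (coset x) < n)%N by apply: ffun; exists x.
pose c x : 'I_n := Ordinal (fP x).
have cE x y : c x = c y <-> V (x^-1 * y)%g.
  rewrite -cosetE; split=> [/(congr1 val) /= xy|xy]; last by apply: val_inj; rewrite /= xy.
  by apply: finj => //; rewrite inE; [exists x|exists y].
have csurj i : exists x, c x = i.
  have [_ [x _ <-] fi] := fsurj i (ltn_ord i).
  by exists x; apply: val_inj.
have [r rK] := choice csurj.
have cM x x' y y' : c x = c x' -> c y = c y' -> c (x * y)%g = c (x' * y')%g.
  move=> /cE Vx /cE Vy; apply/cE.
  have -> : ((x * y)^-1 * (x' * y') = (y^-1 * y') * (x^-1 * x') ^ y')%g.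
    by rewrite invgM conjgE !mulgA mulgK.
  by apply: VM => //; exact: VJ.
by exists (FiniteQuotient rK cM).
Qed.

(** Frattini argument: a proper closed subgroup stays proper in some finite $p$-quotient, lies there
    in a maximal subgroup, and is killed by the resulting nonzero character. *)
Lemma subgroup_by_characters (p : nat) (F : topologicalGroupType) (H : set F) :
    prime p -> pro_p_group p F -> subgroup H -> closed H ->
    (forall psi : F -> 'F_p, H1 psi -> (forall x, H x -> psi x = 0) -> forall x, psi x = 0) ->
  H = [set: F].
Proof.
move=> p_pr [cF hF tF idx] [H1' HM HV] cH sep; apply/seteqP; split=> // g _.
apply: contrapT => nHg.
(* Since [H] is closed, some coset [g V] misses it, so the image of [g] in $F/V$ is not in that of
   [H]. *)
have [|V [oV nV VH]] := open_normal_basis (U := [set v | ~ H (g * v)%g]) cF hF tF.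
  apply: open_nbhs_nbhs; split; last by rewrite /= mulg1.
  apply: (@open_preimage _ _ (fun v => g * v)%g (~` H)); last exact: closed_openC.
  by apply: mulg_continuous_fun; [exact: cst_continuous_fun|exact: id_continuous_fun].
have [k /(finite_quotient_exists nV) [q [qp qV]]] := idx V oV nV.
pose Q : finGroupType := quotient_type q; pose c : F -> Q := to_quotient q.
have cM : {morph c : x y / (x * y)%g} by exact: to_quotientM.
have pQ : (p.-group [set: Q]%SET)%g.
  by rewrite /pgroup cardsT card_ord qp pnatX pnat_id.
have cE x y : c x = c y <-> V (x^-1 * y)%g by exact: qV.
have c1 : c 1%g = 1%g by apply: (mulgI (c 1%g)); rewrite -cM !mulg1.
have csurj i : exists x, c x = i by exact: to_quotient_surj.
pose D : {set Q} := [set i | `[< exists2 h, H h & c h = i >]]%SET.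
have DP i : i \in D <-> exists2 h, H h & c h = i.
  by rewrite inE; split=> /asboolP.
have D_group : group_set D.
  apply/group_setP; split; first by apply/DP; exists 1%g.
  move=> i j /DP [x Hx <-] /DP [y Hy <-].
  by apply/DP; exists (x * y)%g; [exact: HM | rewrite cM].
have [DQ|[M maxM DM]] := maximal_exists (finset.subsetT (Group D_group)).
  have : c g \in D by rewrite -[D]/(gval (Group D_group)) DQ inE.
  move=> /DP [h Hh /esym/cE /VH]; apply.
  by rewrite mulVKg.
(* The quotient by a maximal subgroup is cyclic of order $p$; [psi] will be the discrete logarithm
   to a generator [a]. *)
have /andP[_ nM] := p_maximal_normal pQ maxM.
have QM : #|[set: Q]%SET / M|%g = p by rewrite card_quotient // (p_maximal_index pQ maxM).
have /cyclicP [a aE] : cyclic ([set: Q]%SET / M)%g by apply: prime_cyclic; rewrite QM.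
have oa : #[a]%g = p by rewrite orderE -aE.
have log_ex x : exists i : 'F_p, coset M (c x) = (a ^+ i)%g.
  have : coset M (c x) \in <[a]>%g by rewrite -aE mem_quotient ?inE.
  case/cyclePmin => i; rewrite oa => ip ->; exists (i%:R).
  by rewrite val_Fp_nat // modn_small.
have [psi psiE] := choice log_ex.
have ltFp (i : 'F_p) : (i < p)%N by rewrite -[X in (_ < X)%N](Fp_cast p_pr) ltn_ord.
have a_inj (i j : 'F_p) : (a ^+ i = a ^+ j)%g -> i = j.
  move=> /eqP; rewrite eq_expg_mod_order oa => /eqP; rewrite !modn_small //.
  exact: val_inj.
have chM x y : coset M (c (x * y)%g) = (coset M (c x) * coset M (c y))%g.
  by rewrite cM morphM // (fintype.subsetP nM) ?inE.
have psiM x y : psi (x * y)%g = psi x + psi y.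
  apply: a_inj; rewrite -psiE chM !psiE -expgD.
  have -> : psi x + psi y = ((psi x + psi y)%N%:R : 'F_p) by rewrite natrD !natr_Zp.
  rewrite val_Fp_nat //; move: (psi x + psi y)%N => n.
  by rewrite -oa expg_mod_order.
have : forall x, psi x = 0.
  apply: sep.
    split=> // e.
    apply: (open_subgroup_invariant nV.1 oV) => x v /= <- Vv; apply: a_inj.
    by rewrite -!psiE; congr (coset M _); apply/esym/cE; rewrite mulKg.
  move=> x Hx; apply: a_inj; rewrite -psiE expg0; apply: coset_id.
  by apply: (fintype.subsetP DM); apply/DP; exists x.
have [b bE] : exists b, coset M (c b) = a.
  have : a \in ([set: Q]%SET / M)%g by rewrite aE cycle_id.
  by case/morphimP => i _ _ ->; have [x <-] := csurj i; exists x.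
move=> /(_ b) psib; have := psiE b; rewrite psib bE expg0 => a1.
by move: oa; rewrite a1 order1 => p1; move: p_pr; rewrite -p1.
Qed.

(** * Finite groups with the discrete topology *)

Definition discrete_group (gT : finGroupType) : Type := gT.

Section DiscreteGroup.
Variable gT : finGroupType.
HB.instance Definition _ := Group.copy (discrete_group gT) gT.
HB.instance Definition _ := hasNbhs.Build (discrete_group gT) principal_filter.
HB.instance Definition _ := Discrete_ofNbhs.Build (discrete_group gT) erefl.

Lemma discrete_continuous (T : topologicalType) (S : discreteTopologicalType) (f : S -> T) :
  continuous f.
Proof. by move=> x A /nbhs_singleton Afx; rewrite nbhs_principalE; exact/principal_filterP. Qed.

Lemma discrete_mulg_continuous :
  continuous (fun xy : discrete_group gT * discrete_group gT => (xy.1 * xy.2)%g).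
Proof.
move=> [x y] A /nbhs_singleton /= Axy.
exists ([set x], [set y]); first by split; rewrite /= nbhs_principalE; exact/principal_filterP.
by move=> [u v] [/= -> ->].
Qed.

Lemma discrete_invg_continuous : continuous (fun x : discrete_group gT => (x^-1)%g).
Proof. exact: discrete_continuous. Qed.

HB.instance Definition _ := Topological_isTopologicalGroup.Build (discrete_group gT)
  discrete_mulg_continuous discrete_invg_continuous.

Lemma discrete_group_pro_p (p : nat) : prime p -> (p.-group [set: gT]%SET)%g ->
  pro_p_group p (discrete_group gT).
Proof.
move=> p_pr pgT; split.
- by apply: finite_compact; exact: (@finite_finset gT).
- exact: discrete_hausdorff.
- exact/zero_dimension_totally_disconnected/discrete_zero_dimension.
- move=> U _ [[U1 UM UV] _].
  pose H : {set gT} := [set x | `[< U x >]]%SET.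
  have HP x : x \in H <-> U x by rewrite inE; split=> /asboolP.
  have gH : group_set H.
    apply/group_setP; split; first exact/HP.
    by move=> x y /HP Ux /HP Uy; apply/HP; exact: UM.
  pose HG := Group gH.
  have /p_natP [k kE] : (p.-nat #|[set: gT]%SET : HG|)%g.
    exact: pnat_dvd (dvdn_indexg _ _) pgT.
  exists k; rewrite -kE.
  pose L := enum (lcosets H [set: gT]%SET).
  have sizeL : size L = #|[set: gT]%SET : HG|%g.
    by rewrite -cardE; exact: (card_lcosets [group of [set: gT]%SET] HG).
  pose f (A : set gT) := index [set x | `[< A x >]]%SET L.
  have fE (g : gT) :
      [set x | `[< [set (g * u)%g | u in U]%classic x >]]%SET = (g *: H)%g.
    apply/setP => x; rewrite inE mem_lcoset; apply/asboolP/idP => [[u Uu <-]|/HP Ux].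
      by rewrite mulKg; exact/HP.
    by exists (g^-1 * x)%g => //; rewrite mulVKg.
  apply/card_set_bijP; exists f; split.
  - move=> _ [g _ <-]; rewrite /f fE /=. rewrite -sizeL index_mem mem_enum.
    by apply/lcosetsP; exists g; rewrite ?inE.
  - move=> _ _ /set_mem [g _ <-] /set_mem [h _ <-]; rewrite /f !fE => gh.
    have gL (g' : gT) : (g' *: H)%g \in L.
      by rewrite mem_enum; apply/lcosetsP; exists g'; rewrite ?inE.
    have {}gh : (g *: H = h *: H)%g.
      by rewrite -(nth_index finset.set0 (gL g)) gh (nth_index finset.set0 (gL h)).
    apply/seteqP; split=> x.
      have := fE g; rewrite gh -(fE h) => /setP /(_ x); rewrite !inE => E xg.
      by apply/asboolP; rewrite -E; apply/asboolP.
    have := fE g; rewrite gh -(fE h) => /setP /(_ x); rewrite !inE => E xg.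
    by apply/asboolP; rewrite E; apply/asboolP.
  - move=> i; rewrite /= -sizeL => iL.
    have : nth finset.set0 L i \in L by exact: mem_nth.
    rewrite mem_enum => /lcosetsP [g _ gE].
    exists [set (g * u)%g | u in U]; first by exists g.
    by rewrite /f fE -gE index_uniq ?enum_uniq.
Qed.

End DiscreteGroup.

(** * The truncated Magnus algebra *)

(* The triple (u, v, w) stands for the unit 1 + sum u_i X_i + sum v_ij X_i X_j
   + sum w_ijk X_i X_j X_k of the noncommutative power series over R modulo
   degree 4. *)
Definition magnus (R : finComNzRingType) (d : nat) : Type :=
  ({ffun 'I_d -> R} * {ffun 'I_d * 'I_d -> R} * {ffun 'I_d * 'I_d * 'I_d -> R})%type.

Section Magnus.
Variables (R : finComNzRingType) (d : nat).
HB.instance Definition _ := Finite.on (magnus R d).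

Definition mag1 (m : magnus R d) i : R := m.1.1 i.
Definition mag2 (m : magnus R d) i j : R := m.1.2 (i, j).
Definition mag3 (m : magnus R d) i j k : R := m.2 (i, j, k).

Definition magnus_of (u : 'I_d -> R) (v : 'I_d -> 'I_d -> R)
    (w : 'I_d -> 'I_d -> 'I_d -> R) : magnus R d :=
  ([ffun i => u i], [ffun t => v t.1 t.2], [ffun t => w t.1.1 t.1.2 t.2]).

Lemma mag1_of u v w i : mag1 (magnus_of u v w) i = u i.
Proof. by rewrite /mag1 ffunE. Qed.
Lemma mag2_of u v w i j : mag2 (magnus_of u v w) i j = v i j.
Proof. by rewrite /mag2 ffunE. Qed.
Lemma mag3_of u v w i j k : mag3 (magnus_of u v w) i j k = w i j k.
Proof. by rewrite /mag3 ffunE. Qed.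

Lemma magnusP (m n : magnus R d) : (forall i, mag1 m i = mag1 n i) ->
  (forall i j, mag2 m i j = mag2 n i j) ->
  (forall i j k, mag3 m i j k = mag3 n i j k) -> m = n.
Proof.
case: m n => [[u v] w] [[u' v'] w'] h1 h2 h3; congr (_, _, _); apply/ffunP.
- by move=> i; exact: h1.
- by case=> i j; exact: h2.
- by case=> [[i j] k]; exact: h3.
Qed.

Definition magnus_mul (m n : magnus R d) := magnus_of
  (fun i => mag1 m i + mag1 n i)
  (fun i j => mag2 m i j + mag2 n i j + mag1 m i * mag1 n j)
  (fun i j k => mag3 m i j k + mag3 n i j k + mag1 m i * mag2 n j k + mag2 m i j * mag1 n k).
Definition magnus_one := magnus_of (fun=> 0) (fun _ _ => 0) (fun _ _ _ => 0).
(** The truncated geometric series $1-a+a^2-a^3$ for the unit $1+a$. *)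
Definition magnus_inv (m : magnus R d) := magnus_of
  (fun i => - mag1 m i)
  (fun i j => mag1 m i * mag1 m j - mag2 m i j)
  (fun i j k => - mag3 m i j k + mag1 m i * mag2 m j k + mag2 m i j * mag1 m k
     - mag1 m i * mag1 m j * mag1 m k).

Let magE := (mag1_of, mag2_of, mag3_of).

Lemma magnus_mulA : associative magnus_mul.
Proof. by move=> m n l; apply: magnusP => *; rewrite !magE; ring. Qed.
Lemma magnus_mul1 : left_id magnus_one magnus_mul.
Proof. by move=> m; apply: magnusP => *; rewrite !magE; ring. Qed.
Lemma magnus_mulV : left_inverse magnus_one magnus_inv magnus_mul.
Proof. by move=> m; apply: magnusP => *; rewrite !magE; ring. Qed.

HB.instance Definition _ := Finite_isGroup.Build (magnus R d)
  magnus_mulA magnus_mul1 magnus_mulV.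

Lemma mag1M m n i : mag1 (m * n)%g i = mag1 m i + mag1 n i.
Proof. exact: mag1_of. Qed.
Lemma mag2M m n i j : mag2 (m * n)%g i j = mag2 m i j + mag2 n i j + mag1 m i * mag1 n j.
Proof. exact: mag2_of. Qed.
Lemma mag3M m n i j k : mag3 (m * n)%g i j k =
  mag3 m i j k + mag3 n i j k + mag1 m i * mag2 n j k + mag2 m i j * mag1 n k.
Proof. exact: mag3_of. Qed.
Lemma mag1_1 i : mag1 1%g i = 0. Proof. exact: mag1_of. Qed.
Lemma mag2_1 i j : mag2 1%g i j = 0. Proof. exact: mag2_of. Qed.
Lemma mag3_1 i j k : mag3 1%g i j k = 0. Proof. exact: mag3_of. Qed.

(* [ring] misses equalities of coefficients that hold only up to unfolding
   canonical structures, so coefficients are abstracted first. *)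
Ltac mag_ring :=
  repeat match goal with
  | |- context [mag1 ?m ?i] => move: (mag1 m i) => ?
  | |- context [mag2 ?m ?i ?j] => move: (mag2 m i j) => ?
  | |- context [mag3 ?m ?i ?j ?k] => move: (mag3 m i j k) => ?
  end; ring.

(** Solves a linear equation [a = b] for an unknown coefficient [x], leaving an identity for
    [ring]. *)
Lemma eq_by_difference (V : zmodType) (a b x y : V) : a = b -> x - y = b - a -> x = y.
Proof. by move=> ->; rewrite subrr => /eqP; rewrite subr_eq0 => /eqP. Qed.

Lemma mag1X m n i : mag1 (m ^+ n)%g i = n%:R * mag1 m i.
Proof.
elim: n => [|n IHn]; first by rewrite expg0 mag1_1 mul0r.
by rewrite expgS mag1M IHn mulrS; mag_ring.
Qed.
Lemma mag2X m n i j : mag2 (m ^+ n)%g i j =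
  n%:R * mag2 m i j + 'C(n, 2)%:R * (mag1 m i * mag1 m j).
Proof.
elim: n => [|n IHn]; first by rewrite expg0 mag2_1 bin0n !mul0r addr0.
by rewrite expgS mag2M IHn mag1X binS bin1 natrD mulrS; mag_ring.
Qed.
Lemma mag3X m n i j k : mag3 (m ^+ n)%g i j k =
  n%:R * mag3 m i j k
  + 'C(n, 2)%:R * (mag1 m i * mag2 m j k + mag2 m i j * mag1 m k)
  + 'C(n, 3)%:R * (mag1 m i * mag1 m j * mag1 m k).
Proof.
elim: n => [|n IHn]; first by rewrite expg0 mag3_1 !bin0n !mul0r !addr0.
by rewrite expgS mag3M IHn mag1X mag2X !binS bin1 !natrD mulrS; mag_ring.
Qed.

(** The coefficients of a commutator are read off degree by degree from $zy = yz[z,y]$, without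
    expanding inverses. *)
Lemma mag1R z y i : mag1 [~ z, y]%g i = 0.
Proof.
move: [~ z, y]%g (commgC z y) => c /(congr1 (fun m => mag1 m i)); rewrite !mag1M.
by move=> /eq_by_difference; apply; mag_ring.
Qed.
Lemma mag2R z y i j :
  mag2 [~ z, y]%g i j = mag1 z i * mag1 y j - mag1 y i * mag1 z j.
Proof.
move: [~ z, y]%g (commgC z y) (mag1R z y) => c /(congr1 (fun m => mag2 m i j)) + c1.
by rewrite !(mag2M, mag1M, c1) => /eq_by_difference; apply; mag_ring.
Qed.
Lemma mag3R z y i j k : (forall l, mag1 z l = 0) ->
  mag3 [~ z, y]%g i j k = mag2 z i j * mag1 y k - mag1 y i * mag2 z j k.
Proof.
move=> z0; move: [~ z, y]%g (commgC z y) (mag1R z y) (mag2R z y) => c.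
move=> /(congr1 (fun m => mag3 m i j k)) + c1 c2.
by rewrite !(mag3M, mag2M, mag1M, c1, c2, z0) => /eq_by_difference; apply; mag_ring.
Qed.
(** Units without terms of degree 1 and 2 are central: their products with positive degree are
    truncated. *)
Lemma magR z y : (forall l, mag1 z l = 0) -> (forall i j, mag2 z i j = 0) -> [~ z, y]%g = 1%g.
Proof.
move=> z1 z2; apply: magnusP => [i|i j|i j k].
- by rewrite mag1R mag1_1.
- by rewrite mag2R !z1 mag2_1; mag_ring.
- by rewrite mag3R // !z2 mag3_1; mag_ring.
Qed.

(** Only $\binom p1$, $\binom p2$ and $\binom p3$ occur, and all vanish in characteristic $p>3$; for
    $p=3$ the cubic term would survive. *)
Lemma magnus_expg p (m : magnus R d) : p \in [pchar R] -> (3 < p)%N -> (m ^+ p = 1)%g.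
Proof.
move=> /andP [p_pr /eqP pE] p3.
have binE k : (0 < k < p)%N -> 'C(p, k)%:R = 0 :> R.
  by move=> kp; have /dvdnP [q ->] := prime_dvd_bin p_pr kp; rewrite natrM pE mulr0.
apply: magnusP => [i|i j|i j k];
  by rewrite ?(mag1X, mag2X, mag3X, mag1_1, mag2_1, mag3_1) pE ?binE ?mul0r ?addr0 //
    (ltn_trans _ p3).
Qed.

Lemma magnus_pgroup p : (p.-nat #|R|)%N -> (p.-group [set: magnus R d]%SET)%g.
Proof.
move=> pR; rewrite /pgroup cardsT /magnus !card_prod !card_ffun.
by rewrite !pnatM !pnatX pR.
Qed.

End Magnus.

(** * Generation along the lower central series *)

Lemma subgroup_conj_cancel (G : topologicalGroupType) (A : set G) (a b : G) :
  subgroup A -> A a -> A (a * b)%g -> A b.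
Proof. by move=> [_ AM AV] Aa Aab; rewrite -(mulKg a b); apply: AM => //; exact: AV. Qed.

Lemma commMgJ (G : groupType) (x y z : G) : [~ x * y, z]%g = ([~ x, z] ^ y * [~ y, z])%g.
Proof. by rewrite !commgEl !conjgE !(invgM, mulgA, mulgK, mulgVK). Qed.

Lemma commgMJ (G : groupType) (x y z : G) : [~ x, y * z]%g = ([~ x, z] * [~ x, y] ^ z)%g.
Proof. by rewrite !commgEl !conjgE !(invgM, mulgA, mulgK, mulgVK). Qed.

Section CentralSeries.
Context {G : topologicalGroupType}.
Variable N : set G.
Hypothesis N_normal : normal_subgroup N.

(** Stands in for the preimage of the [i]-th term of the lower central series of $G/N$. *)
Definition lcs_mod (i : nat) : set G := closed_subgroup_gen (lcs i `|` N).
Local Notation L := lcs_mod.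

Lemma lcs_mod_closed i : closed (L i).
Proof. exact: closed_subgroup_gen_closed. Qed.

Lemma lcs_mod_normal i : normal_subgroup (L i).
Proof.
apply: closed_subgroup_gen_normal => x g [ix|Nx]; [left|right].
  exact: (lcs_normal i).2.
exact: N_normal.2.
Qed.

Lemma lcs_mod_subgroup i : subgroup (L i).
Proof. exact: (lcs_mod_normal i).1. Qed.

Lemma lcs_mod_lcs i : lcs i `<=` L i.
Proof. by move=> x ix; apply: closed_subgroup_gen_sub; left. Qed.

Lemma lcs_mod_N i : N `<=` L i.
Proof. by move=> x ix; apply: closed_subgroup_gen_sub; right. Qed.

Lemma lcs_mod1 : L 1 = [set: G].
Proof. by apply/seteqP; split=> // x _; apply: lcs_mod_lcs. Qed.

Lemma lcs_mod_eq i : closed N -> lcs i `<=` N -> L i = N.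
Proof.
move=> cN iN; apply/seteqP; split; last exact: lcs_mod_N.
apply: closed_subgroup_gen_min => //; first exact: N_normal.1.
by move=> x [/iN|].
Qed.

Lemma lcs_modR i x y : (0 < i)%N -> L i x -> L i.+1 [~ x, y]%g.
Proof.
move=> i0 ix; have [[L1 LM LV] LJ] := lcs_mod_normal i.+1.
apply: (closed_subgroup_gen_min (A := [set x | L i.+1 [~ x, y]%g])) ix.
- split=> /= [|u v Lu Lv|u Lu]; first by rewrite comm1g.
  + by rewrite commMgJ; apply: LM => //; exact: LJ.
  + apply: (@subgroup_conj_cancel _ (L i.+1) ([~ u, y] ^ u^-1)%g); [by split|exact: LJ|].
    by rewrite -commMgJ mulgV comm1g.
- apply: (@closed_preimage _ _ (fun x => [~ x, y]%g)); last exact: lcs_mod_closed.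
  apply: mulg_continuous_fun; first exact: invg_continuous.
  by apply: conjg_continuous_fun; [exact: id_continuous_fun|exact: cst_continuous_fun].
- move=> u [iu|Nu] /=; first by apply: lcs_mod_lcs; exact: lcsR.
  apply: lcs_mod_N; have [_ NM NV] := N_normal.1.
  by apply: NM; [exact: NV|exact: N_normal.2].
Qed.

(** Topological generation of [L i] by [W] modulo [L i.+1], phrased through closed subgroups so that
    no quotient is formed. *)
Definition generates_layer (W : set G) (i : nat) : Prop :=
  forall P : set G, subgroup P -> closed P -> L i.+1 `<=` P -> W `<=` P -> L i `<=` P.

(** Modulo [L i.+2] the commutator is bilinear on [L i] and $G$, so commutators of generators
    generate the next layer. *)
Lemma generates_layerS (Y W : set G) i :
    (forall P : set G, subgroup P -> closed P -> Y `<=` P -> P = [set: G]) ->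
    (0 < i)%N -> W `<=` L i -> generates_layer W i ->
  generates_layer [set z | exists w y, [/\ W w, Y y & z = [~ w, y]%g]] i.+1.
Proof.
move=> Ygen i0 WL Wgen P sP cP LP comP; have [P1 PM PV] := sP.
(* Conjugating $[u,y]$ changes it only by an element of [L i.+2], hence of [P]; this gives the
   bilinearity. *)
have PJ u y v : L i u -> P [~ u, y]%g -> P ([~ u, y] ^ v)%g.
  move=> Lu Puy; apply: subgroupJ => //; apply: LP.
  by apply: lcs_modR => //; exact: lcs_modR.
(* Additivity in the first variable, the second being a fixed generator. *)
have LiP y : Y y -> L i `<=` [set u | L i u /\ P [~ u, y]%g].
  move=> Yy; have [L1 LM LV] := lcs_mod_subgroup i; apply: Wgen.
  - split=> /= [|u v [Lu Pu] [Lv Pv]|u [Lu Pu]].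
    + by rewrite comm1g.
    + by split; [exact: LM|rewrite commMgJ; apply: PM => //; exact: PJ].
    + split; first exact: LV.
      apply: (@subgroup_conj_cancel _ P ([~ u, y] ^ u^-1)%g) => //; first exact: PJ.
      by rewrite -commMgJ mulgV comm1g.
  - apply: closedI; first exact: lcs_mod_closed.
    apply: (@closed_preimage _ _ (fun x => [~ x, y]%g)) => //.
    apply: mulg_continuous_fun; first exact: invg_continuous.
    by apply: conjg_continuous_fun; [exact: id_continuous_fun|exact: cst_continuous_fun].
  - move=> u Lu /=; split; last by apply: LP; exact: lcs_modR.
    have [_ LiM LiV] := lcs_mod_subgroup i.
    apply: (closed_subgroup_gen_min (A := L i)) Lu => //; first exact: lcs_mod_closed.
    move=> v [iv|]; last exact: lcs_mod_N.
    apply: lcs_mod_lcs; move: iv; rewrite lcsS //.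
    apply: closed_subgroup_gen_min; [exact: (lcs_normal i).1|exact: lcs_closed|].
    move=> _ [a [b [ia ->]]]; have [[_ iM iV] iJ] := @lcs_normal G i.
    by apply: iM; [exact: iV|exact: iJ].
  - move=> w Ww; split; first exact: WL.
    by apply: comP; exists w, y.
(* Additivity in the second variable, now for all [u] at once. *)
have centralE : \bigcap_(u in L i) [set y | P [~ u, y]%g] = [set: G].
  apply: Ygen.
  - split=> [u _|y z Py Pz u Lu|y Py u Lu] /=; first by rewrite commg1.
    + by rewrite commgMJ; apply: PM; [exact: Pz|apply: PJ => //; exact: Py].
    + have := PJ u y y^-1%g Lu (Py u Lu).
      rewrite -[X in P X -> _]invgK => /PV; rewrite invgK.
      have -> // : (([~ u, y] ^ y^-1)^-1 = [~ u, y^-1])%g.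
      by apply/esym/eqP; rewrite -mulg_eq1 -commgMJ mulgV commg1.
  - apply: closed_bigI => u _; apply: (@closed_preimage _ _ (fun y => [~ u, y]%g)) => //.
    apply: mulg_continuous_fun; first exact: cst_continuous_fun.
    by apply: conjg_continuous_fun; [exact: cst_continuous_fun|exact: id_continuous_fun].
  - by move=> y Yy u Lu; have [] := LiP y Yy u Lu.
apply: closed_subgroup_gen_min => // u [|Nu]; last by apply: LP; exact: lcs_mod_N.
rewrite lcsS //; apply: closed_subgroup_gen_min => // _ [x [y [ix ->]]].
have : (\bigcap_(u in L i) [set y | P [~ u, y]%g]) y by rewrite centralE.
by apply; exact: lcs_mod_lcs.
Qed.

(* The products [w1^e1 ... wn^en x] with [x] in [L i.+1]. *)
Fixpoint layer_products (q i : nat) (ws : seq G) : set G :=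
  if ws is w :: ws' then \bigcup_(e in `I_q) [set z | layer_products q i ws' (w ^- e * z)%g]
  else L i.+1.

Section Layer.
Variables (q i : nat).
Hypothesis q0 : (0 < q)%N.
Hypothesis i0 : (0 < i)%N.
Hypothesis NX : forall x, N (x ^+ q)%g.
Local Notation P := (layer_products q i).

Lemma layer_products_closed ws : closed (P ws).
Proof.
elim: ws => [|w ws IH] /=; first exact: lcs_mod_closed.
apply: closed_bigcup => [|e _]; first exact: finite_II.
apply: (@closed_preimage _ _ (fun z => w ^- e * z)%g) => //.
by apply: mulg_continuous_fun; [exact: cst_continuous_fun|exact: id_continuous_fun].
Qed.

(** Factors may be permuted because commutators of elements of [L i] fall into [L i.+1], and
    exponents count only modulo [q] because [q]-th powers lie in [N]. *)
Lemma layer_products_subgroup ws : {in ws, forall w, L i w} ->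
  [/\ subgroup (P ws), L i.+1 `<=` P ws & P ws `<=` L i].
Proof.
elim: ws => [|w ws IH] wsL.
  split=> //; first exact: lcs_mod_subgroup.
  apply: closed_subgroup_gen_min; [exact: lcs_mod_subgroup|exact: lcs_mod_closed|].
  move=> x [|]; last exact: lcs_mod_N.
  rewrite lcsS // => ix; apply: lcs_mod_lcs; move: ix.
  apply: closed_subgroup_gen_min; [exact: (lcs_normal i).1|exact: lcs_closed|].
  move=> _ [a [b [ia ->]]]; have [[_ iM iV] iJ] := @lcs_normal G i.
  by apply: iM; [exact: iV|exact: iJ].
have [|sP LP PL] := IH; first by move=> u uws; apply: wsL; rewrite inE uws orbT.
have [P1 PM PV] := sP; have wL : L i w by apply: wsL; rewrite inE eqxx.
have [L1 LM LV] := lcs_mod_subgroup i.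
have PJ x g : P ws x -> P ws (x ^ g)%g.
  move=> Px; apply: subgroupJ => //; apply: LP; apply: lcs_modR => //; exact: PL.
have PE z : P (w :: ws) z <-> exists e, P ws (w ^- e * z)%g.
  split=> [[e _ Pz]|[e Pz]]; first by exists e.
  exists (e %% q)%N; first by rewrite /= ltn_pmod.
  rewrite /=; suff -> : (w ^- (e %% q) * z = (w ^+ (e %/ q)) ^+ q * (w ^- e * z))%g.
    by apply: PM => //; apply: LP; apply: lcs_mod_N.
  have wE : (w ^+ e = w ^+ (e %% q) * w ^+ (e %/ q * q))%g.
    by rewrite -expgnDr addnC -divn_eq.
  by rewrite -expgnA wE invgM !mulgA mulgV mul1g.
split.
- split.
  + by apply/PE; exists 0%N; rewrite expg0 invg1 mul1g.
  + move=> x y /PE [e Px] /PE [f Py]; apply/PE; exists (e + f)%N.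
    have -> : (w ^- (e + f) * (x * y) = (w ^- e * x) ^ (w ^+ f) * (w ^- f * y))%g.
      by rewrite expgnDr conjgE !(invgM, mulgA, mulgK, mulgVK).
    by apply: PM => //; exact: PJ.
  (* $e(q-1)$ is $-e$ modulo $q$, written as a natural number. *)
  + move=> x /PE [e Px]; apply/PE; exists (e * q.-1)%N.
    have wE : (w ^+ (e * q) = w ^+ e * w ^+ (e * q.-1))%g by rewrite -expgnDr -mulnS prednK.
    have -> : (w ^- (e * q.-1) * x^-1 =
        ((w ^+ e) ^+ q)^-1 * ((w ^- e * x)^-1 ^ (w ^+ e)^-1))%g.
      by rewrite -expgnA wE conjgE !(invgM, mulgA, mulgK, mulgVK, invgK).
    by apply: PM; [exact: (PV _ (LP _ (@lcs_mod_N i.+1 _ (NX _))))|exact: (PJ _ _ (PV _ Px))].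
- by move=> x Lx; apply/PE; exists 0%N; rewrite expg0 invg1 mul1g; exact: LP.
- move=> x /PE [e /PL Lx]; rewrite -(mulVKg (w ^+ e)%g x).
  by apply: LM => //; exact: (subgroupX _ (lcs_mod_subgroup i)).
Qed.

Lemma layer_products_sub ws : {in ws, forall w, L i w} -> {in ws, forall w, P ws w}.
Proof.
elim: ws => [//|w ws IH] wsL u.
have {}wsL' : {in ws, forall w, L i w} by move=> v vws; apply: wsL; rewrite inE vws orbT.
have [[P1 PM PV] LP PL] := layer_products_subgroup wsL'.
rewrite inE => /orP [/eqP ->|uws] /=.
  (* The reduction covers [q = 1], where the only exponent allowed is 0. *)
  exists (1 %% q)%N; first by rewrite /= ltn_pmod.
  have [q1|] := leqP q 1.
    have q1' : q = 1%N by apply/eqP; rewrite eqn_leq q1.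
    have -> : (1 %% q = 0)%N by rewrite q1' modnn.
    rewrite /= expg0 invg1 mul1g; apply: LP; apply: lcs_mod_N.
    by rewrite -[w]expg1 -q1'.
  by move=> q1; rewrite /= modn_small // expg1 mulVg.
exists 0%N => //=; rewrite expg0 invg1 mul1g; exact: IH.
Qed.

(** The set of products is itself a closed subgroup of the kind tested in [generates_layer]; this
    yields a normal form for every element of [L i]. *)
Lemma generates_layer_products ws : {in ws, forall w, L i w} ->
  generates_layer [set w | w \in ws] i -> L i = P ws.
Proof.
move=> wsL; have [sP LP PL] := layer_products_subgroup wsL.
move=> /(_ (P ws)) gen; apply/seteqP; split=> //; apply: gen => //.
  exact: layer_products_closed.
exact: layer_products_sub.
Qed.

(** Dropping one generator passes to a closed subgroup of finite index, whose complement is a finite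
    union of closed cosets. *)
Lemma layer_products_open ws : {in ws, forall w, L i w} -> open (P ws) -> open (L i.+1).
Proof.
elim: ws => [//|w ws IH] wsL oP.
have {}wsL : {in ws, forall w, L i w} by move=> u uws; apply: wsL; rewrite inE uws orbT.
apply: IH => //; have [[P1 PM PV] _ _] := layer_products_subgroup wsL.
pose E := `I_q `&` [set e | ~ P ws (w ^- e)%g].
pose coset e := [set z | P ws (w ^- e * z)%g].
have -> : P ws = P (w :: ws) `&` ~` \bigcup_(e in E) coset e.
  apply/seteqP; split=> [z Pz|z [[e eq Pz] nz]].
    split; first by exists 0%N; rewrite //= expg0 invg1 mul1g.
    by move=> [e [_ +] Pez]; apply; rewrite -(mulgK z (w ^- e)%g); apply: PM => //; exact: PV.
  have [Pwe|nPwe] := pselect (P ws (w ^- e)%g); last by case: nz; exists e.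
  by apply: subgroup_conj_cancel Pz.
apply: openI => //; apply: closed_openC; apply: closed_bigcup.
  by apply: finite_setIl; exact: finite_II.
move=> e _; apply: (@closed_preimage _ _ (fun z => w ^- e * z)%g).
  by apply: mulg_continuous_fun; [exact: cst_continuous_fun|exact: id_continuous_fun].
exact: layer_products_closed.
Qed.

End Layer.

(** Each layer is finitely generated of bounded exponent, hence finite, so openness passes down from
    $G$; the generators of a layer are carried along the induction. *)
Lemma lcs_mod_open (Y : seq G) (q n : nat) :
    (forall P : set G, subgroup P -> closed P -> {in Y, forall y, P y} -> P = [set: G]) ->
    (0 < q)%N -> (forall x, N (x ^+ q)%g) -> (0 < n)%N -> open (L n).
Proof.
move=> Ygen q0 NX n0.
have Ygen' (P : set G) : subgroup P -> closed P -> [set y | y \in Y] `<=` P -> P = [set: G].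
  by move=> sP cP YP; apply: Ygen.
suff [] : open (L n) /\ exists ws : seq G, {in ws, forall w, L n w} /\
    generates_layer [set w | w \in ws] n by [].
case: n n0 => // n _; elim: n => [|n [oL [ws [wsL wsgen]]]].
  split; first by rewrite lcs_mod1; exact: openT.
  exists Y; split; first by rewrite lcs_mod1.
  by move=> P sP cP _ YP x _; rewrite (Ygen' P).
split.
  apply: (layer_products_open q0 _ NX wsL) => //.
  by rewrite -(generates_layer_products q0 _ NX wsL wsgen).
exists [seq [~ w, y]%g | w <- ws, y <- Y]; split.
  move=> _ /allpairsP [[w y] [/= ws_w _ ->]]; apply: lcs_modR => //; exact: wsL.
move=> P sP cP LP comP; apply: (generates_layerS Ygen' (ltn0Sn n) wsL wsgen) => //.
by move=> _ [w [y [ws_w Yy ->]]]; apply: comP; apply/allpairsP; exists (w, y).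
Qed.

End CentralSeries.

(** * Magnus coordinates of the Zassenhaus filtration *)

Lemma lcs_mono (G : topologicalGroupType) i j : (0 < i)%N -> (i <= j)%N ->
  lcs j `<=` (lcs i : set G).
Proof.
move=> i0 /subnK <-; elim: (j - i)%N => // n IH; apply: subset_trans IH.
rewrite addSn lcsS ?addn_gt0 ?i0 ?orbT //.
have [[_ iM iV] iJ] := @lcs_normal G (n + i).
apply: closed_subgroup_gen_min; [exact: (lcs_normal _).1|exact: lcs_closed|].
by move=> _ [a [b [ia ->]]]; apply: iM; [exact: iV|exact: iJ].
Qed.

Lemma ord2P (P : 'I_2 -> Prop) : P 0 -> P 1 -> forall i, P i.
Proof. by move=> P0 P1 [[|[|//]] lti]; [move: P0|move: P1]; congr P; exact: val_inj. Qed.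

Section MagnusCoordinates.
Context (p : nat) {F : topologicalGroupType}.
Hypothesis p_pr : prime p.
Hypothesis p_gt3 : (3 < p)%N.
Variable y : 'I_2 -> F.
Hypothesis y_gen : forall P : set F, subgroup P -> closed P -> (forall i, P (y i)) -> P = [set: F].
Variable mu : F -> discrete_group (magnus 'F_p 2).
Hypothesis mu_hom : continuous_hom mu.
Hypothesis mu_dual : forall i j, mag1 (mu (y j)) i = (i == j)%:R.

Local Notation Z := (zassenhaus p : nat -> set F).

(** With [N] taken to be $F_n$ itself, [lcs_mod n] is $F_n$; the exponent $p^n$ works because $n\le
    p^n$. *)
Lemma zassenhaus_open n : (0 < n)%N -> open (Z n).
Proof.
move=> n0; rewrite -(@lcs_mod_eq _ (Z n) (zassenhaus_normal p n) n); last first.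
- exact: zassenhaus_lcs.
- exact: zassenhaus_closed.
apply: (@lcs_mod_open _ _ (zassenhaus_normal p n) [:: y 0; y 1] (p ^ n)) => //.
- move=> P sP cP YP; apply: y_gen => // i; apply: YP; rewrite !inE.
  by case: i => [[|[|//]] lti]; apply/orP; [left|right]; apply/eqP; congr y; exact: val_inj.
- by rewrite expn_gt0 prime_gt0.
- by move=> x; apply: zassenhausX; exact/ltnW/ltn_expl/prime_gt1.
Qed.

Let muM : {morph mu : a b / (a * b)%g}. Proof. exact: mu_hom.2. Qed.
Let mu1 : mu 1%g = 1%g.
Proof. by apply: (mulgI (mu 1%g)); rewrite -muM !mulg1. Qed.
Let muV a : mu (a^-1)%g = (mu a)^-1%g.
Proof. by apply: (mulgI (mu a)); rewrite -muM !mulgV. Qed.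
Let muX a n : mu (a ^+ n)%g = (mu a ^+ n)%g.
Proof. by elim: n => [|n IHn]; rewrite ?expg0 // !expgS muM IHn. Qed.
Let muR a b : mu [~ a, b]%g = [~ mu a, mu b]%g.
Proof. by rewrite !commgEl !conjgE !muM !muV. Qed.

(** The sets [depth2], [depth3], [depth4] are the units whose nonconstant terms have at least that
    degree; in degree 4 truncation leaves only 1. *)
Definition depth2 : set (discrete_group (magnus 'F_p 2)) := [set m | forall i, mag1 m i = 0].
Definition depth3 : set (discrete_group (magnus 'F_p 2)) :=
  [set m | depth2 m /\ forall i j, mag2 m i j = 0].
Definition depth4 : set (discrete_group (magnus 'F_p 2)) := [set m | m = 1%g].

Lemma depth2_subgroup : subgroup depth2.
Proof.
split=> [i|m n m0 n0 i|m m0 i]; first exact: mag1_1.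
  by rewrite mag1M m0 n0 addr0.
by rewrite mag1_of m0 oppr0.
Qed.

Lemma depth3_subgroup : subgroup depth3.
Proof.
have [d1 dM dV] := depth2_subgroup.
split=> [|m n [m1 m2] [n1 n2]|m [m1 m2]].
- by split=> // i j; exact: mag2_1.
- by split=> [|i j]; [exact: dM|rewrite mag2M m1 m2 n2 mul0r !addr0].
- by split=> [|i j]; [exact: dV|rewrite mag2_of m1 m2 mul0r subr0].
Qed.

Lemma depth4_subgroup : subgroup depth4.
Proof.
split=> [//|m n -> ->|m ->]; first by rewrite /depth4 /= mulg1.
by rewrite /depth4 /= invg1.
Qed.

Lemma preimage_subgroup A : subgroup A -> subgroup [set g | A (mu g)].
Proof.
move=> [A1 AM AV]; split=> /= [|a b|a]; rewrite ?mu1 ?muM ?muV //; first exact: AM.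
exact: AV.
Qed.

Lemma preimage_closed A : closed [set g | A (mu g)].
Proof. by apply: closed_preimage; [exact: mu_hom.1|exact: discrete_closed]. Qed.

Lemma lcs_depth i (A B : set (discrete_group (magnus 'F_p 2))) : (0 < i)%N -> subgroup B ->
  (forall g, lcs i g -> A (mu g)) -> (forall m n, A m -> B [~ m, n]%g) ->
  forall g, lcs i.+1 g -> B (mu g).
Proof.
move=> i0 sB iA AB; rewrite lcsS //.
apply: (closed_subgroup_gen_min (A := [set g | B (mu g)])).
- exact: preimage_subgroup.
- exact: preimage_closed.
- by move=> _ [a [b [/iA Aa ->]]] /=; rewrite muR; exact: AB.
Qed.

Lemma lcs_depth2 g : lcs 2 g -> depth2 (mu g).
Proof.
by apply: (@lcs_depth 1 setT) => // [|m n _ i]; [exact: depth2_subgroup|exact: mag1R].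
Qed.

Lemma lcs_depth3 g : lcs 3 g -> depth3 (mu g).
Proof.
apply: (@lcs_depth 2 depth2) => //; first exact: depth3_subgroup.
  exact: lcs_depth2.
move=> m n m1; split=> [i|i j]; first exact: mag1R.
by rewrite mag2R !m1 mul0r mulr0 subrr.
Qed.

Lemma lcs_depth4 g : lcs 4 g -> depth4 (mu g).
Proof.
apply: (@lcs_depth 3 depth3) => //; first exact: depth4_subgroup.
  exact: lcs_depth3.
by move=> m n [m1 m2]; exact: magR.
Qed.

Lemma mu_expg j g : (0 < j)%N -> mu (g ^+ (p ^ j))%g = 1%g.
Proof.
case: j => // j _; rewrite muX expnSr expgnA.
by apply: magnus_expg => //; exact: pchar_Fp.
Qed.

(** Generators of $F_n$ that are proper $p$-powers die under [mu], so only the lower central series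
    matters. *)
Lemma zassenhaus_depth n (A : set (discrete_group (magnus 'F_p 2))) : subgroup A -> (0 < n)%N ->
  (forall g, lcs n g -> A (mu g)) -> forall g, Z n g -> A (mu g).
Proof.
move=> sA n0 nA; apply: (closed_subgroup_gen_min (A := [set g | A (mu g)])).
- exact: preimage_subgroup.
- exact: preimage_closed.
- move=> _ [i [j [x [i0 nij ix ->]]]] /=; have [A1 _ _] := sA.
  case: j nij => [|j] nij; last by rewrite mu_expg.
  by rewrite expn0 expg1; apply: nA; apply: lcs_mono ix => //; rewrite expn0 muln1 in nij.
Qed.

Lemma zassenhaus3_depth g : Z 3 g -> depth3 (mu g).
Proof. by apply: zassenhaus_depth => //; [exact: depth3_subgroup|exact: lcs_depth3]. Qed.

Lemma zassenhaus4_depth g : Z 4 g -> mu g = 1%g.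
Proof. by apply: (@zassenhaus_depth 4 depth4) => //; [exact: depth4_subgroup|exact: lcs_depth4]. Qed.

Local Notation L := (lcs_mod (Z 4)).
Let Z4n := zassenhaus_normal p 4 : normal_subgroup (Z 4).

Let Z4X x : Z 4 (x ^+ p)%g.
Proof. by have := @zassenhausX F p 4 1 x; rewrite expn1; apply. Qed.

Lemma lcs_mod_depth n A : subgroup A ->
  (forall g, lcs n g -> A (mu g)) -> forall g, L n g -> A (mu g).
Proof.
move=> sA nA; apply: (closed_subgroup_gen_min (A := [set g | A (mu g)])).
- exact: preimage_subgroup.
- exact: preimage_closed.
- by move=> g [/nA //|/zassenhaus4_depth /= ->]; have [] := sA.
Qed.

Lemma natr_Fp_eq0 e : (e < p)%N -> e%:R = 0 :> 'F_p -> e = 0%N.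
Proof.
move=> ep /eqP; rewrite -(dvdn_pcharf (pchar_Fp p_pr)) => pe.
by apply/eqP; rewrite -leqn0 leqNgt; apply: contraL ep => e0; rewrite -leqNgt dvdn_leq.
Qed.

Let c := [~ y 0, y 1%R]%g.

Lemma layer1 : generates_layer (Z 4) [set w | w \in [:: y 0; y 1]] 1.
Proof.
move=> P sP cP _ YP g _; rewrite (y_gen sP cP) //.
by apply: ord2P; apply: YP; rewrite /= !inE eqxx ?orbT.
Qed.

Let seq_gen (P : set F) : subgroup P -> closed P -> [set w | w \in [:: y 0; y 1]] `<=` P ->
  P = [set: F].
Proof.
by move=> sP cP YP; apply: y_gen => //; apply: ord2P; apply: YP; rewrite /= !inE eqxx ?orbT.
Qed.

(** With two generators the only commutators are 1, [c] and its inverse. *)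
Lemma layer2 : generates_layer (Z 4) [set w | w \in [:: c]] 2.
Proof.
move=> P sP cP LP cP'; apply: (generates_layerS Z4n seq_gen (ltn0Sn 0) _ layer1) => //.
  by move=> w _; rewrite lcs_mod1.
have [P1 PM PV] := sP; have Pc : P c by apply: cP'; rewrite /= inE.
have Pc' : P [~ y 1%R, y 0]%g by rewrite -invgR; exact: PV.
move=> _ [w [z [/= + + ->]]]; rewrite !inE => /orP [] /eqP -> /orP [] /eqP ->.
- by rewrite commgg.
- exact: Pc.
- exact: Pc'.
- by rewrite commgg.
Qed.

Let L2c : L 2 c.
Proof. by apply: (lcs_modR Z4n) => //; rewrite lcs_mod1. Qed.

Lemma layer3 : generates_layer (Z 4) [set w | w \in [:: [~ c, y 0]; [~ c, y 1%R]]%g] 3.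
Proof.
move=> P sP cP LP dP; apply: (generates_layerS Z4n seq_gen (ltn0Sn 1) _ layer2) => //.
  by move=> w; rewrite /= inE => /eqP ->.
move=> _ [w [z [/= + + ->]]]; rewrite !inE => /eqP -> /orP [] /eqP ->;
  by apply: dP; rewrite /= !inE eqxx ?orbT.
Qed.

Let dual00 : mag1 (mu (y 0)) 0 = 1. Proof. exact: mu_dual. Qed.
Let dual01 : mag1 (mu (y 0)) 1 = 0. Proof. exact: mu_dual. Qed.
Let dual10 : mag1 (mu (y 1)) 0 = 0. Proof. exact: mu_dual. Qed.
Let dual11 : mag1 (mu (y 1)) 1 = 1. Proof. exact: mu_dual. Qed.

Let dualE := (dual00, dual01, dual10, dual11).

(** Write [g] as $y_0^e y_1^f$ times an element of [L 2]: the linear coefficients of [mu g] are $e$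
    and $f$, both below $p$, so their vanishing modulo $p$ forces $e=f=0$. *)
Lemma depth2_lcs_mod g : depth2 (mu g) -> L 2 g.
Proof.
move=> g1; have : L 1 g by rewrite lcs_mod1.
rewrite (generates_layer_products Z4n (prime_gt0 p_pr) _ Z4X _ layer1) //; last first.
  by move=> w _; rewrite lcs_mod1.
move=> [e ep [f fp L2]].
have /lcs_mod_depth := L2 => /(_ _ depth2_subgroup lcs_depth2) E.
have := E 0; have := E 1; rewrite !muM !muV !muX !mag1M !mag1_of !mag1X !dualE !g1.
rewrite !mulr0 !mulr1 !oppr0 !addr0 add0r => /eqP; rewrite oppr_eq0 => /eqP /(natr_Fp_eq0 fp) f0.
move=> /eqP; rewrite oppr_eq0 => /eqP /(natr_Fp_eq0 ep) e0.
by move: L2; rewrite e0 f0 !expg0 !invg1 /= !mul1g.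
Qed.

Lemma depth3_lcs_mod g : depth3 (mu g) -> L 3 g.
Proof.
move=> [g1 g2]; have := depth2_lcs_mod g1.
rewrite (generates_layer_products Z4n (prime_gt0 p_pr) _ Z4X _ layer2) //; last first.
  by move=> w; rewrite inE => /eqP ->.
move=> [e ep L3].
have /lcs_mod_depth := L3 => /(_ _ depth3_subgroup lcs_depth3) [_ /(_ 0 1)].
rewrite muM muV muX muR mag2M !mag2_of !mag1_of !mag1X !mag2X !mag1R !mag2R !dualE g2.
rewrite !(mul0r, mulr0, mulr1, subr0, addr0, sub0r, oppr0) => /eqP.
rewrite oppr_eq0 => /eqP /(natr_Fp_eq0 ep) e0.
by move: L3; rewrite e0 expg0 invg1 /= mul1g.
Qed.

Lemma depth3_zassenhaus3 g : depth3 (mu g) -> Z 3 g.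
Proof.
move=> /depth3_lcs_mod; apply: closed_subgroup_gen_min.
- exact: (zassenhaus_normal p 3).1.
- exact: zassenhaus_closed.
- move=> h [h3|]; first exact: zassenhaus_lcs.
  exact: zassenhausS.
Qed.

(** Modulo $F_4$ the element is $[c,y_0]^e[c,y_1]^f$, whose coefficients at $X_0X_0X_1$ and
    $X_1X_1X_0$ are $-e$ and $f$. *)
Lemma zassenhaus4P g : Z 3 g -> mag3 (mu g) 0 0 1 = 0 -> mag3 (mu g) 1 1 0 = 0 -> Z 4 g.
Proof.
move=> /zassenhaus3_depth g12 g3 g3'; have [g1 g2] := g12; have := depth3_lcs_mod g12.
rewrite (generates_layer_products Z4n (prime_gt0 p_pr) _ Z4X _ layer3) //; last first.
  by move=> w; rewrite !inE => /orP [] /eqP ->; exact: (lcs_modR Z4n).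
move=> [e ep [f fp L4]].
have c1 i : mag1 (mu c) i = 0 by rewrite muR mag1R.
have c2 i j : mag2 (mu c) i j = (i == 0)%:R * (j == 1)%:R - (i == 1)%:R * (j == 0)%:R.
  by rewrite muR mag2R !mu_dual.
have /lcs_mod_depth := L4 => /(_ _ depth4_subgroup lcs_depth4) /= E.
have := congr1 (fun m => mag3 m 0 0 1) E; have := congr1 (fun m => mag3 m 1 1 0) E.
rewrite !muM !muV !muX.
have dR i j : mag1 (mu [~ c, y j]%g) i = 0 by rewrite muR mag1R.
have dR2 i j k : mag2 (mu [~ c, y k]%g) i j = 0 by rewrite muR mag2R !c1 mul0r mulr0 subrr.
have dR3 i j k l : mag3 (mu [~ c, y l]%g) i j k =
    mag2 (mu c) i j * mag1 (mu (y l)) k - mag1 (mu (y l)) i * mag2 (mu c) j k.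
  by rewrite muR mag3R.
rewrite !mag3M !mag3_of !mag1_of !mag2_of !mag3X !mag1X !mag2X !dR !dR2 !dR3 !c2 !dualE !g1 !g2 g3 g3'.
rewrite /= !(mul0r, mulr0, mul1r, mulr1, addr0, add0r, subr0, sub0r, oppr0, opprK) => E1 E2.
have f0 : f = 0%N by apply: (natr_Fp_eq0 fp); apply/eqP; rewrite -oppr_eq0 E1.
have e0 : e = 0%N by apply: (natr_Fp_eq0 ep); rewrite -E2 mulrN1 opprK.
rewrite -(lcs_mod_eq Z4n (@zassenhaus_closed _ p 4) (@zassenhaus_lcs _ p 4 isT)).
by move: L4; rewrite e0 f0 !expg0 !invg1 /= !mul1g.
Qed.

End MagnusCoordinates.

(** * Cochains and presentations *)

Section Cochains.
Context (p : nat).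

Lemma cochain_cst (T : topologicalType) (a : 'F_p) : cochain (fun _ : T => a).
Proof.
move=> b; have [->|ab] := eqVneq a b.
  by rewrite (_ : _ @^-1` _ = setT); [exact: openT|apply/seteqP; split].
rewrite (_ : _ @^-1` _ = set0); first exact: open0.
by apply/seteqP; split=> // t /= /eqP; rewrite (negbTE ab).
Qed.

Lemma cochain_map2 (T : topologicalType) (h : 'F_p -> 'F_p -> 'F_p) (f g : T -> 'F_p) :
  cochain f -> cochain g -> cochain (fun t => h (f t) (g t)).
Proof.
move=> cf cg a.
rewrite (_ : _ @^-1` _ = \bigcup_(bc in [set bc : 'F_p * 'F_p | h bc.1 bc.2 = a])
    (f @^-1` [set bc.1] `&` g @^-1` [set bc.2])).
  by apply: bigcup_open => -[b c] _; apply: openI.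
by apply/seteqP; split=> [t ta|t [[b c] /= <- [/= -> ->]] //]; exists (f t, g t).
Qed.

Lemma cochainD (T : topologicalType) (f g : T -> 'F_p) :
  cochain f -> cochain g -> cochain (fun t => f t + g t).
Proof. exact: cochain_map2. Qed.

Lemma cochainB (T : topologicalType) (f g : T -> 'F_p) :
  cochain f -> cochain g -> cochain (fun t => f t - g t).
Proof. exact: (@cochain_map2 _ (fun a b => a - b)). Qed.

Lemma cochainM (T : topologicalType) (f g : T -> 'F_p) :
  cochain f -> cochain g -> cochain (fun t => f t * g t).
Proof. exact: cochain_map2. Qed.

Lemma cochainZ (T : topologicalType) (a : 'F_p) (f : T -> 'F_p) :
  cochain f -> cochain (fun t => a * f t).
Proof. by move=> cf; apply: cochainM => //; exact: cochain_cst. Qed.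

Lemma cochain_sum (T : topologicalType) (I : Type) (r : seq I) (f : I -> T -> 'F_p) :
  (forall i, cochain (f i)) -> cochain (fun t => \sum_(i <- r) f i t).
Proof.
move=> cf; elim: r => [|i r IH].
  by rewrite (_ : (fun _ => _) = fun=> 0); [exact: cochain_cst|apply/funext => t; rewrite big_nil].
rewrite (_ : (fun _ => _) = fun t => f i t + \sum_(i <- r) f i t); first exact: cochainD.
by apply/funext => t; rewrite big_cons.
Qed.

Lemma cochain_pullback (T U : topologicalType) (h : T -> U) (f : U -> 'F_p) :
  continuous h -> cochain f -> cochain (fun t => f (h t)).
Proof. by move=> ch cf a; exact: (@open_preimage _ _ h (f @^-1` [set a])). Qed.

Lemma cochain_from_discrete (T : topologicalType) (S : discreteTopologicalType) (h : T -> S)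
  (k : S -> 'F_p) : continuous h -> cochain (fun t => k (h t)).
Proof. by move=> ch; apply: (@cochain_pullback _ _ h k) => // a; exact: discrete_open. Qed.

Lemma cochain_to_discrete (T : topologicalType) (S : discreteTopologicalType)
  (f : T -> 'F_p) (k : 'F_p -> S) : cochain f -> continuous (fun t => k (f t)).
Proof.
move=> cf; apply/continuousP => A _.
rewrite (_ : _ @^-1` A = \bigcup_(a in [set a | A (k a)]) (f @^-1` [set a])).
  by apply: bigcup_open => a _; exact: cf.
by apply/seteqP; split=> [t At|t [a Aa /= ->]] //; exists (f t).
Qed.

Lemma H1_1 (G : topologicalGroupType) (psi : G -> 'F_p) : H1 psi -> psi 1%g = 0.
Proof. by move=> [_ psiM]; apply: (addrI (psi 1%g)); rewrite -psiM mulg1 addr0. Qed.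

Lemma H1X (G : topologicalGroupType) (psi : G -> 'F_p) g n : H1 psi ->
  psi (g ^+ n)%g = n%:R * psi g.
Proof.
move=> psi1; elim: n => [|n IH]; first by rewrite expg0 (H1_1 psi1) mul0r.
by rewrite expgS psi1.2 IH mulrS mulrDl mul1r.
Qed.

Lemma H1_pullback (F G : topologicalGroupType) (h : F -> G) (psi : G -> 'F_p) :
  continuous_hom h -> H1 psi -> H1 (fun g => psi (h g)).
Proof.
move=> [ch hM] [cpsi psiM]; split; first exact: cochain_pullback.
by move=> x y; rewrite hM psiM.
Qed.

Lemma H1_combination (G : topologicalGroupType) d (c : 'rV['F_p]_d) (chi : 'I_d -> G -> 'F_p) :
  (forall i, H1 (chi i)) -> H1 (fun g => \sum_(i < d) c 0 i * chi i g).
Proof.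
move=> chi1; split.
  by apply: cochain_sum => i; apply: cochainZ; exact: (chi1 i).1.
by move=> x y; rewrite -big_split; apply: eq_bigr => i _; rewrite (chi1 i).2 mulrDr.
Qed.

End Cochains.

Lemma hom1 (F G : topologicalGroupType) (h : F -> G) : continuous_hom h -> h 1%g = 1%g.
Proof. by move=> [_ hM]; apply: (mulgI (h 1%g)); rewrite -hM !mulg1. Qed.

Lemma homV (F G : topologicalGroupType) (h : F -> G) g : continuous_hom h -> h (g^-1)%g = (h g)^-1%g.
Proof.
by move=> hh; apply: (mulgI (h g)); rewrite -hh.2 !mulgV hom1.
Qed.

(** The first conclusion is existence in the universal property, the second is uniqueness, applied
    to a character seen as a homomorphism to a finite $p$-group. *)
Lemma free_pro_p_coordinates (p d : nat) (F : topologicalGroupType) :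
    prime p -> free_pro_p_group p d F ->
  exists x : 'I_d -> F,
    (forall gT : finGroupType, (p.-group [set: gT]%SET)%g -> forall y : 'I_d -> gT,
       exists mu : F -> discrete_group gT, continuous_hom mu /\ forall i, mu (x i) = y i) /\
    (forall psi : F -> 'F_p, H1 psi -> (forall i, psi (x i) = 0) -> forall g, psi g = 0).
Proof.
move=> p_pr [_ [x xU]]; exists x; split.
  move=> gT pgT y; have [mu [muP _]] := xU _ (discrete_group_pro_p p_pr pgT) y.
  by exists mu.
move=> psi psi1 psix g.
have pM : (p.-group [set: magnus 'F_p 1]%SET)%g.
  by apply: magnus_pgroup; rewrite card_Fp // pnat_id.
(* The cubic coefficient embeds the additive group of $\mathbb{F}_p$ into a multiplicative $p$-group
   already at hand. *)
pose k (a : 'F_p) : discrete_group (magnus 'F_p 1) :=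
  magnus_of (fun=> 0) (fun _ _ => 0) (fun _ _ _ => a).
have [mu [_ muU]] := xU _ (discrete_group_pro_p p_pr pM) (fun=> 1%g).
have k0 : k 0 = 1%g by [].
have h1 : mu = fun g => k (psi g).
  apply: muU; split; last by move=> i; rewrite psix.
  split; first exact: cochain_to_discrete psi1.1.
  move=> a b; apply: magnusP => *;
    by rewrite !(mag1M, mag2M, mag3M, mag1_of, mag2_of, mag3_of) ?psi1.2 ?mul0r ?addr0.
have h2 : mu = fun=> 1%g.
  apply: muU; split=> //; split; first exact: cst_continuous_fun.
  by move=> a b; rewrite mulg1.
have := congr1 (fun m : F -> magnus 'F_p 1 => mag3 (m g) 0 0 0) h1.
by rewrite h2 !mag3_of.
Qed.

Section PresentationCoordinates.
Context (p : nat) {F G : topologicalGroupType} (pi : F -> G).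
Hypothesis p_pr : prime p.
Hypothesis pi_min : minimal_presentation p pi 2.
Variable chi : 'I_2 -> G -> 'F_p.
Hypothesis chi_basis : H1_basis chi.

Let pi_hom : continuous_hom pi. Proof. by case: pi_min. Qed.
Let chiF i : H1 (fun g => chi i (pi g)).
Proof. exact: H1_pullback (chi_basis.1 i). Qed.

Lemma hom_surj g : exists h, pi h = g.
Proof.
case: pi_min => _ _ piT _; have : [set: G] g by [].
by rewrite -piT => -[h _ <-]; exists h.
Qed.

(** A row vector annihilating the matrix is a combination of the [chi i] vanishing on all [x j],
    hence zero on $F$ and, by surjectivity of [pi], on $G$. *)
Lemma basis_matrix_unit (x : 'I_2 -> F) :
    (forall psi : F -> 'F_p, H1 psi -> (forall i, psi (x i) = 0) -> forall g, psi g = 0) ->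
  \matrix_(i, j) chi i (pi (x j)) \in unitmx.
Proof.
move=> x_sep; rewrite -row_free_unit; apply: inj_row_free => v vM.
have [|c [_ cU]] := chi_basis.2 (fun=> 0).
  by split=> [|? ?]; [exact: cochain_cst|rewrite addr0].
rewrite -(cU 0) ?(cU v) // => g; last first.
  by rewrite big1 // => i _; rewrite mxE mul0r.
have [h <-] := hom_surj g; apply/esym.
apply: (x_sep (fun h => \sum_(i < 2) v 0 i * chi i (pi h))).
  exact: (@H1_combination _ _ _ v (fun i h => chi i (pi h))).
move=> j; have := congr1 (fun w : 'rV_2 => w 0 j) vM; rewrite !mxE => E; rewrite -[RHS]E.
by apply: eq_bigr => i _; rewrite mxE.
Qed.

(** This is where minimality acts: inflation is onto in degree 1, so every character of $F$ vanishes
    on the relations. Later arguments build cochains on $F$ whose coboundaries cancel and conclude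
    by it. *)
Lemma H1_inflated (psi : F -> 'F_p) : H1 psi ->
  exists c : 'rV['F_p]_2, forall g, psi g = \sum_(i < 2) c 0 i * chi i (pi g).
Proof.
case: pi_min => freeF _ _ _ psi1.
have [x [_ x_sep]] := free_pro_p_coordinates p_pr freeF.
have uM := basis_matrix_unit x_sep; set M := (X in X \in unitmx) in uM.
pose c := (\row_j psi (x j)) *m invmx M; exists c => g; apply/eqP; rewrite -subr_eq0; apply/eqP.
apply: (x_sep (fun g => psi g - \sum_(i < 2) c 0 i * chi i (pi g))).
  have [cc cM] := @H1_combination _ _ _ c (fun i h => chi i (pi h)) chiF.
  split; first by apply: cochainB => //; exact: psi1.1.
  by move=> a b; rewrite psi1.2 cM; ring.
move=> j; apply/eqP; rewrite subr_eq0; apply/eqP.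
have : (c *m M) 0 j = psi (x j) by rewrite mulmxKV // mxE.
by rewrite mxE => <-; apply: eq_bigr => i _; rewrite !mxE.
Qed.

Lemma magnus_coordinates :
  exists (y : 'I_2 -> F) (mu : F -> discrete_group (magnus 'F_p 2)),
    [/\ forall P : set F, subgroup P -> closed P -> (forall i, P (y i)) -> P = [set: F],
        continuous_hom mu, forall g i, mag1 (mu g) i = chi i (pi g)
      & forall i j, chi i (pi (y j)) = (i == j)%:R].
Proof.
case: pi_min => freeF _ _ _; have [pF _] := freeF.
have [x [x_free x_sep]] := free_pro_p_coordinates p_pr freeF.
have uM := basis_matrix_unit x_sep; set M := (X in X \in unitmx) in uM.
have pMag : (p.-group [set: magnus 'F_p 2]%SET)%g.
  by apply: magnus_pgroup; rewrite card_Fp // pnat_id.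
have [mu [mu_hom mux]] := x_free _ pMag
  (fun j => magnus_of (fun i => chi i (pi (x j))) (fun _ _ => 0) (fun _ _ _ => 0)).
(* The exponents are the columns of the inverse matrix, which makes [y] dual to [chi]. *)
pose y j := (x 0%R ^+ (invmx M 0%R j) * x 1%R ^+ (invmx M 1%R j))%g.
have chi_y i j : chi i (pi (y j)) = (i == j)%:R.
  have : (M *m invmx M) i j = (i == j)%:R by rewrite mulmxV // mxE.
  rewrite mxE big_ord_recl big_ord1 !mxE => <-.
  have h1 := chiF i; rewrite /y (h1.2) !(H1X _ _ h1) !natr_Zp.
  by rewrite [LHS]addrC addrC; congr (_ + _); rewrite mulrC; congr (chi _ (pi (x _)) * invmx M _ _);
    exact: val_inj.
exists y, mu; split=> //.
- move=> P sP cP Py; apply: (subgroup_by_characters p_pr pF sP cP) => psi psi1 psiP.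
  have [c psiE] := H1_inflated psi1.
  have c0 j : c 0 j = 0.
    rewrite -(psiP _ (Py j)) psiE (bigD1 j) //= chi_y eqxx mulr1 big1 ?addr0 // => i ij.
    by rewrite chi_y (negbTE ij) mulr0.
  by move=> g; rewrite psiE big1 // => i _; rewrite c0 mul0r.
- move=> g i; apply/eqP; rewrite -subr_eq0; apply/eqP.
  apply: (x_sep (fun g => mag1 (mu g) i - chi i (pi g))).
    split; last by move=> a b; rewrite mu_hom.2 mag1M (chiF i).2; ring.
    apply: cochainB; last exact: (chiF i).1.
    by apply: (@cochain_from_discrete _ _ _ mu (fun m => mag1 m i)); exact: mu_hom.1.
  by move=> j; rewrite mux mag1_of subrr.
Qed.

End PresentationCoordinates.

Lemma hom_ker_normal (F G : topologicalGroupType) (h : F -> G) : continuous_hom h ->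
  normal_subgroup (hom_ker h).
Proof.
move=> hh; have hM := hh.2.
split; last by move=> r g Rr; rewrite /hom_ker /= conjgE !hM Rr mul1g (homV _ hh) mulVg.
split=> [|a b Ra Rb|a Ra]; first exact: hom1.
  by rewrite /hom_ker /= hM Ra Rb mulg1.
by rewrite /hom_ker /= (homV _ hh) Ra invg1.
Qed.

(** * Massey products and their traces in Magnus coordinates *)

Section MasseyTrace.
Context (p : nat) {F G : topologicalGroupType} (pi : F -> G).
Hypothesis p_pr : prime p.
Hypothesis pi_min : minimal_presentation p pi 2.
Variable chi : 'I_2 -> G -> 'F_p.
Hypothesis chi_basis : H1_basis chi.
Variable f : 'I_2 -> 'I_2 -> G -> 'F_p.
Hypothesis f_cochain : forall i j, cochain (f i j).
Hypothesis f_cup : forall i j s, cup (chi i) (chi j) s = coboundary (f i j) s.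
Variable mu : F -> discrete_group (magnus 'F_p 2).
Hypothesis mu_hom : continuous_hom mu.
Hypothesis mu_chi : forall g i, mag1 (mu g) i = chi i (pi g).

Let pi_hom : continuous_hom pi. Proof. by case: pi_min. Qed.
Let muM : {morph mu : a b / (a * b)%g}. Proof. exact: mu_hom.2. Qed.
Let piM : {morph pi : a b / (a * b)%g}. Proof. exact: pi_hom.2. Qed.
Local Notation R := (hom_ker pi).

Definition massey_cocycle (i j k : 'I_2) (s : G * G) : 'F_p :=
  cup (chi i) (f j k) s + cup (f i j) (chi k) s.

Lemma cup_cochain_1 i j : f i j 1%g = 0.
Proof.
have := f_cup i j (1, 1)%g; rewrite /cup /coboundary /= mulg1 (H1_1 (chi_basis.1 i)) mul0r.
by rewrite addrK => <-.
Qed.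

(** In the sign convention of [coboundary], [mag2] has coboundary $-\chi_i\cup\chi_j$, opposite to
    that of [f i j]; their sum is a character of $F$. *)
Lemma cup_cochain_inflated i j : exists l : 'rV['F_p]_2,
  forall g, f i j (pi g) = \sum_(m < 2) l 0 m * chi m (pi g) - mag2 (mu g) i j.
Proof.
have [|l lE] := @H1_inflated p F G pi p_pr pi_min chi chi_basis
    (fun g => f i j (pi g) + mag2 (mu g) i j).
  split.
    apply: cochainD; first by apply: cochain_pullback => //; exact: pi_hom.1.
    by apply: (@cochain_from_discrete _ _ _ mu (fun m => mag2 m i j)); exact: mu_hom.1.
  move=> a b; have := f_cup i j (pi a, pi b); rewrite /cup /coboundary /= => E.
  by rewrite piM muM mag2M !mu_chi E; ring.
by exists l => g; rewrite -lE addrK.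
Qed.

Lemma relation_depth3 r : R r -> depth3 (mu r).
Proof.
move=> Rr; have mu1 i : mag1 (mu r) i = 0 by rewrite mu_chi Rr (H1_1 (chi_basis.1 i)).
split=> // i j; have [l lE] := cup_cochain_inflated i j.
have := lE r; rewrite Rr cup_cochain_1 big1 ?sub0r => [/esym/eqP|m _].
  by rewrite oppr_eq0 => /eqP.
by rewrite (H1_1 (chi_basis.1 m)) mulr0.
Qed.

(** The multiplication rule of [mag3] is the Massey cocycle with each [f] replaced by $-$[mag2]. The
    two differ by characters, which the subtracted sums correct; these sums vanish on the
    relations. *)
Lemma massey_cocycle_inflated i j k : exists y : F -> 'F_p,
  [/\ cochain y, forall s, coboundary y s = massey_cocycle i j k (pi s.1, pi s.2)
    & forall r, R r -> y r = mag3 (mu r) i j k].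
Proof.
have [l lE] := cup_cochain_inflated j k; have [l' l'E] := cup_cochain_inflated i j.
exists (fun g => mag3 (mu g) i j k - \sum_(m < 2) l 0 m * mag2 (mu g) i m
                 - \sum_(m < 2) l' 0 m * mag2 (mu g) m k).
have mag_cochain (h : discrete_group (magnus 'F_p 2) -> 'F_p) : cochain (fun g => h (mu g)).
  by apply: cochain_from_discrete; exact: mu_hom.1.
split.
- apply: cochainB; [apply: cochainB|]; first exact: (mag_cochain (fun m => mag3 m i j k)).
    by apply: cochain_sum => m; apply: cochainZ; exact: (mag_cochain (fun n => mag2 n i m)).
  by apply: cochain_sum => m; apply: cochainZ; exact: (mag_cochain (fun n => mag2 n m k)).
- move=> [a b]; rewrite /massey_cocycle /cup /coboundary /= lE l'E muM mag3M.
  rewrite !big_ord_recl !big_ord0 !mag2M !mu_chi.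
  move: (mag3 (mu a) i j k) (mag3 (mu b) i j k) => ? ?; ring.
- move=> r Rr; have [m1 m2] := relation_depth3 Rr.
  by rewrite !big1 ?subr0 // => m _; rewrite m2 mulr0.
Qed.

Lemma massey_cocycleP i j k : Z2 (massey_cocycle i j k).
Proof.
have c_chi l := (chi_basis.1 l).1; have chiM l := (chi_basis.1 l).2.
split.
  apply: cochainD; apply: cochainM; first
    [by apply: (@cochain_pullback _ _ _ fst) => // x; exact: cvg_fst
    |by apply: (@cochain_pullback _ _ _ snd) => // x; exact: cvg_snd].
move=> a b c; have := f_cup j k (b, c); have := f_cup i j (a, b).
rewrite /massey_cocycle /cup /coboundary /= !chiM => E1 E2.
have -> : f j k (b * c)%g = f j k b + f j k c - chi j b * chi k c by rewrite E2; ring.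
have -> : f i j (a * b)%g = f i j a + f i j b - chi i a * chi j b by rewrite E1; ring.
ring.
Qed.

Lemma relation_mag3_hom i j k r s : R r -> R s ->
  mag3 (mu (r * s)%g) i j k = mag3 (mu r) i j k + mag3 (mu s) i j k.
Proof.
move=> /relation_depth3 [r1 r2] /relation_depth3 [s1 s2].
by rewrite muM mag3M r1 r2 mul0r mul0r !addr0.
Qed.

Lemma depth3_conj (m n : discrete_group (magnus 'F_p 2)) : depth3 m -> (m ^ n)%g = m.
Proof.
by move=> [m1 m2]; rewrite -[LHS](mulVKg m) -commgEl (magR n m1 m2) mulg1.
Qed.

Lemma mu_conj g h : mu (g ^ h)%g = (mu g ^ mu h)%g.
Proof. by rewrite !conjgE !muM (homV _ mu_hom). Qed.

(** The cochain of [massey_cocycle_inflated] exhibits [mag3] as an inverse image under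
    transgression; the rest is injectivity of transgression, so that the choice in [trace_map] does
    not matter. *)
Lemma trace_massey i j k r : R r ->
  trace_map pi r (massey chi f i j k) = mag3 (mu r) i j k.
Proof.
move=> Rr; have [y [cy yc yR]] := massey_cocycle_inflated i j k.
rewrite /trace_map; apply: xget_unique.
  exists y; split; last by rewrite yR.
  - split.
    + move=> a; exists (y @^-1` [set a]); first exact: cy.
      by [].
    + move=> s t Rs Rt; rewrite !yR //; first exact: relation_mag3_hom.
      by have [[_ RM _] _] := hom_ker_normal pi_hom; exact: RM.
    + move=> s g Rs; rewrite !yR //; last exact: (hom_ker_normal pi_hom).2.
      by rewrite mu_conj depth3_conj //; exact: relation_depth3.
  - exists y, (massey_cocycle i j k); split=> //; exact: massey_cocycleP.
move=> a [x [[_ xM _] [z [c [cz zx [cc cE] zc phiE]]] ->]].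
have [b cb bE] : H2_class c (massey_cocycle i j k).
  rewrite -phiE; exists (fun=> 0); first exact: cochain_cst.
  by move=> s; rewrite /coboundary; rewrite subr0 !addr0.
(* The two extensions differ by the inflation of [b] up to a character of $F$; on the relations only
   the constant [b 1] remains. *)
have [|l lE] := @H1_inflated p F G pi p_pr pi_min chi chi_basis
    (fun g => y g - z g - b (pi g)).
  split.
    apply: cochainB; first exact: cochainB.
    by apply: cochain_pullback => //; exact: pi_hom.1.
  move=> u v; have := yc (u, v); have := zc (u, v); have := bE (pi u, pi v).
  rewrite /coboundary /= piM => E1 E2 E3.
  have -> : y (u * v)%g = y u + y v - massey_cocycle i j k (pi u, pi v) by rewrite -E3; ring.
  have -> : z (u * v)%g = z u + z v - c (pi u, pi v) by rewrite -E2; ring.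
  by rewrite E1; ring.
have const s : R s -> x s = y s - b 1%g.
  move=> Rs; have := lE s; rewrite Rs big1 => [/eqP|m _].
    by rewrite -zx // addrAC subr_eq0 => /eqP.
  by rewrite (H1_1 (chi_basis.1 m)) mulr0.
have R1 : R 1%g by case: (hom_ker_normal pi_hom) => [[]].
(* Evaluation at 1 shows that this constant is zero. *)
have x1 : x 1%g = 0 by apply: (addrI (x 1%g)); rewrite -xM // mulg1 addr0.
have y1 : y 1%g = 0.
  by rewrite yR // (hom1 mu_hom) mag3_1.
have b1 : b 1%g = 0.
  by have := const _ R1; rewrite x1 y1 sub0r => /esym/eqP; rewrite oppr_eq0 => /eqP.
by rewrite const // b1 subr0 yR.
Qed.

End MasseyTrace.

(** * Zassenhaus type (3,3) *)

Section NormalClosure.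
Context {G : topologicalGroupType}.
Implicit Types (A B : set G).

Lemma normal_subgroup_gen_sub A : A `<=` normal_subgroup_gen A.
Proof. exact: sub_gen_smallest. Qed.

Lemma normal_subgroup_gen_min A B : normal_subgroup B -> A `<=` B -> normal_subgroup_gen A `<=` B.
Proof. by move=> nB AB; apply: smallest_sub. Qed.

Lemma normal_subgroup_gen_normal A : normal_subgroup (normal_subgroup_gen A).
Proof.
split=> [|x g Ax B nB]; last by apply: nB.1.2; exact: Ax.
split=> [B [[[]]] //|x y Ax Ay B nB|x Ax B nB]; have [_ BM BV] := nB.1.1.
  by apply: BM; [exact: Ax|exact: Ay].
by apply: BV; exact: Ax.
Qed.

Lemma normal_subgroup_mul A B : normal_subgroup A -> normal_subgroup B ->
  normal_subgroup [set (a * b)%g | a in A & b in B].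
Proof.
move=> [[A1 AM AV] AJ] [[B1 BM BV] BJ]; split; last first.
  move=> _ g [a Aa [b Bb <-]]; exists (a ^ g)%g; first exact: AJ.
  by exists (b ^ g)%g; [exact: BJ|rewrite conjMg].
split.
- by exists 1%g => //; exists 1%g => //; rewrite mulg1.
- move=> _ _ [a Aa [b Bb <-]] [a' Aa' [b' Bb' <-]]; exists (a * a')%g; first exact: AM.
  exists (b ^ a' * b')%g; first by apply: BM => //; exact: BJ.
  by rewrite conjgE !(mulgA, mulgK).
- move=> _ [a Aa [b Bb <-]]; exists (a^-1)%g; first exact: AV.
  exists (b^-1 ^ a^-1)%g; first by apply: BJ; exact: BV.
  by rewrite conjgE invgK invgM !mulgA mulVg mul1g.
Qed.

End NormalClosure.

Lemma generates_modP (p : nat) (F G : topologicalGroupType) (pi : F -> G) k (A : set F) :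
    continuous_hom pi -> A `<=` hom_ker pi ->
  generates_mod p pi k A <-> hom_ker pi `<=` normal_subgroup_gen (A `|` zassenhaus p k.+1).
Proof.
move=> pi_hom AR; have nR := hom_ker_normal pi_hom; have [R1 _ _] := nR.1.
have nZ := zassenhaus_normal (G := F) p k.+1; have [Z1 _ _] := nZ.1.
split=> [gen r Rr|RA].
  by rewrite gen; exists r => //; exists 1%g => //; rewrite mulg1.
apply/seteqP; split.
  apply: normal_subgroup_gen_min; first exact: normal_subgroup_mul.
  move=> a [/AR Ra|Za]; first by exists a => //; exists 1%g => //; rewrite mulg1.
  by exists 1%g => //; exists a => //; rewrite mul1g.
move=> _ [r /RA Ar [z Zz <-]]; have [[_ NM _] _] := normal_subgroup_gen_normal (A `|` zassenhaus p k.+1).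
by apply: NM => //; apply: normal_subgroup_gen_sub; right.
Qed.

Section MasseyCombination.
Context (p : nat) {F G : topologicalGroupType} (pi : F -> G).
Hypothesis p_pr : prime p.
Hypothesis p_gt3 : (3 < p)%N.
Hypothesis G_hausdorff : hausdorff_space G.
Hypothesis pi_min : minimal_presentation p pi 2.
Variable chi : 'I_2 -> G -> 'F_p.
Hypothesis chi_basis : H1_basis chi.
Variable f : 'I_2 -> 'I_2 -> G -> 'F_p.
Hypothesis f_cochain : forall i j, cochain (f i j).
Hypothesis f_cup : forall i j s, cup (chi i) (chi j) s = coboundary (f i j) s.
Variable mu : F -> discrete_group (magnus 'F_p 2).
Hypothesis mu_hom : continuous_hom mu.
Hypothesis mu_chi : forall g i, mag1 (mu g) i = chi i (pi g).

Let pi_hom : continuous_hom pi. Proof. by case: pi_min. Qed.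
Let piM : {morph pi : a b / (a * b)%g}. Proof. exact: pi_hom.2. Qed.
Local Notation R := (hom_ker pi).

(** The general linear functional on $F_3/F_4$ in its two coordinates. *)
Definition mag_comb (a b : 'F_p) (m : magnus 'F_p 2) : 'F_p :=
  a * mag3 m 0 0 1 + b * mag3 m 1 1 0.

Lemma cochain_descends (y : F -> 'F_p) : cochain y ->
  (forall g r, R r -> y (g * r)%g = y g) ->
  exists2 b : G -> 'F_p, cochain b & forall g, b (pi g) = y g.
Proof.
move=> cy yR; have [s sK] := choice (hom_surj pi_min).
have bE g : y (s (pi g)) = y g.
  rewrite -(yR (s (pi g)) ((s (pi g))^-1 * g)%g) ?mulVKg //.
  by rewrite /hom_ker /= piM (homV _ pi_hom) sK mulVg.
exists (fun g => y (s g)) => // a.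
rewrite -[_ @^-1` _]setCK; apply: closed_openC.
have -> : ~` ((fun g => y (s g)) @^-1` [set a]) = pi @` ~` (y @^-1` [set a]).
  apply/seteqP; split=> [g /= na|_ [h na <-] /=]; last by rewrite bE.
  by exists (s g).
apply: compact_closed => //; case: pi_min => -[[cptF _ _ _] _] _ _ _.
apply: continuous_compact; first by apply: continuous_subspaceT; exact: pi_hom.1.
by apply: (subclosed_compact _ cptF) => //; apply: open_closedC; exact: cy.
Qed.

(** The right-hand side mentions only $G$, which carries the condition from one presentation to
    another. If the combination vanishes on the relations, its cochain on $F$ descends to [h];
    conversely that cochain minus the inflated [h] is a character of $F$, trivial on relations. *)
Lemma mag_comb_vanishes (a b : 'F_p) :
  (forall r, R r -> mag_comb a b (mu r) = 0) <->
  (exists2 h : G -> 'F_p, cochain h & forall s,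
     a * massey_cocycle chi f 0 0 1 s + b * massey_cocycle chi f 1 1 0 s = coboundary h s).
Proof.
have [y [cy yc yR]] := massey_cocycle_inflated p_pr pi_min chi_basis f_cochain f_cup mu_hom mu_chi 0 0 1.
have [z [cz zc zR]] := massey_cocycle_inflated p_pr pi_min chi_basis f_cochain f_cup mu_hom mu_chi 1 1 0.
pose t g := a * y g + b * z g.
have ct : cochain t by apply: cochainD; exact: cochainZ.
have tc u v : t u + t v - t (u * v)%g = a * massey_cocycle chi f 0 0 1 (pi u, pi v)
    + b * massey_cocycle chi f 1 1 0 (pi u, pi v).
  have := yc (u, v); have := zc (u, v); rewrite /coboundary /= /t => <- <-; ring.
have tR r : R r -> t r = mag_comb a b (mu r) by move=> Rr; rewrite /t yR ?zR.
have f1 := cup_cochain_1 chi_basis f_cup.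
have chi1 i := H1_1 (chi_basis.1 i).
split=> [van|[h ch hE] r Rr].
  have [g r Rr|h ch hE] := cochain_descends ct.
    have := tc g r; rewrite Rr /massey_cocycle /cup /= !f1 !chi1 !(mulr0, addr0).
    by rewrite (tR r Rr) van // addr0 => /eqP; rewrite subr_eq0 => /eqP.
  exists h => // -[u v]; have [u' <-] := hom_surj pi_min u; have [v' <-] := hom_surj pi_min v.
  by rewrite -tc /coboundary /= -piM !hE.
have [|l lE] := @H1_inflated p F G pi p_pr pi_min chi chi_basis (fun g => t g - h (pi g)).
  split; first by apply: cochainB => //; apply: cochain_pullback => //; exact: pi_hom.1.
  move=> u v; have := tc u v; rewrite hE /coboundary /= -piM => E.
  have -> : t (u * v)%g = t u + t v - (h (pi u) + h (pi v) - h (pi (u * v)%g)) by rewrite -E; ring.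
  by ring.
have h1 : h 1%g = 0.
  have := hE (1, 1)%g; rewrite /massey_cocycle /coboundary /cup /= !f1 !chi1 !(mulr0, mul0r, addr0).
  by rewrite mulg1 addrK.
rewrite -tR //; have := lE r; rewrite Rr h1 subr0 => ->.
by rewrite big1 // => m _; rewrite chi1 mulr0.
Qed.

Lemma mag_comb_normal (a b : 'F_p) :
  normal_subgroup [set h | zassenhaus p 3 h /\ mag_comb a b (mu h) = 0].
Proof.
have [[Z1 ZM ZV] ZJ] := zassenhaus_normal (G := F) p 3.
have d3 h : zassenhaus p 3 h -> depth3 (mu h) by exact: (zassenhaus3_depth p_pr p_gt3 mu_hom).
have combM h h' : zassenhaus p 3 h -> zassenhaus p 3 h' ->
    mag_comb a b (mu (h * h')%g) = mag_comb a b (mu h) + mag_comb a b (mu h').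
  move=> /d3 [h1 h2] /d3 [h1' h2']; rewrite mu_hom.2 /mag_comb !mag3M !h1 !h2 !mul0r !addr0.
  ring.
have comb1 : mag_comb a b (mu 1%g) = 0.
  by apply: (addrI (mag_comb a b (mu 1%g))); rewrite -combM // mulg1 addr0.
split=> [|h g [Zh h0]]; last first.
  split; first exact: ZJ.
  by rewrite (mu_conj mu_hom) depth3_conj //; exact: d3.
split=> [//|h h' [Zh h0] [Zh' h0']|h [Zh h0]].
  by split; [exact: ZM|rewrite combM // h0 h0' addr0].
split; first exact: ZV.
by apply: (addrI (mag_comb a b (mu h))); rewrite -combM ?mulgV ?comb1 ?h0 ?addr0 //; exact: ZV.
Qed.

Variable y : 'I_2 -> F.
Hypothesis y_gen : forall P : set F, subgroup P -> closed P -> (forall i, P (y i)) -> P = [set: F].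
Hypothesis y_dual : forall i j, chi i (pi (y j)) = (i == j)%:R.

Let mu_dual i j : mag1 (mu (y j)) i = (i == j)%:R.
Proof. by rewrite mu_chi y_dual. Qed.

Lemma relations_zassenhaus3 : R `<=` zassenhaus p 3.
Proof.
move=> r Rr; apply: (depth3_zassenhaus3 p_pr p_gt3 y_gen mu_hom mu_dual).
exact: (relation_depth3 p_pr pi_min chi_basis f_cochain f_cup mu_hom mu_chi).
Qed.

(** Under a nontrivial linear condition the relations span at most a line in $F_3/F_4$, and any
    relation off $F_4$ generates it. *)
Lemma one_relation_suffices (a b : 'F_p) : (a != 0) || (b != 0) ->
    (forall r, R r -> mag_comb a b (mu r) = 0) ->
  exists2 r, R r & generates_mod p pi 3 [set r].
Proof.
move=> ab van.
have [t [tM tZ]] : exists t : F -> 'F_p,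
    (forall r s, R r -> R s -> t (r * s)%g = t r + t s) /\
    (forall r, R r -> t r = 0 -> zassenhaus p 4 r).
  have magM := relation_mag3_hom p_pr pi_min chi_basis f_cochain f_cup mu_hom mu_chi.
  have Z4 := zassenhaus4P p_pr p_gt3 y_gen mu_hom mu_dual.
  (* The condition determines one of the two coordinates from the other; [t] is the free one, so it
     alone detects $F_4$ on relations. *)
  have [a0|a0] := eqVneq a 0.
    exists (fun r => mag3 (mu r) 0 0 1); split=> [r s|r Rr t0]; first exact: magM.
    apply: Z4 => //; first exact: relations_zassenhaus3.
    have := van r Rr; rewrite /mag_comb t0 mulr0 add0r => /eqP; rewrite mulf_eq0.
    by move: ab; rewrite a0 eqxx /= => /negbTE -> /eqP.
  exists (fun r => mag3 (mu r) 1 1 0); split=> [r s|r Rr t0]; first exact: magM.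
  apply: Z4 => //; first exact: relations_zassenhaus3.
  have := van r Rr; rewrite /mag_comb t0 mulr0 addr0 => /eqP; rewrite mulf_eq0.
  by rewrite (negbTE a0) => /eqP.
have nR := hom_ker_normal pi_hom; have [R1 RM RV] := nR.1.
have tX r n : R r -> t (r ^+ n)%g = n%:R * t r.
  move=> Rr; elim: n => [|n IH].
    by rewrite expg0 mul0r; apply: (addrI (t 1%g)); rewrite -tM // mulg1 addr0.
  by rewrite expgS tM ?IH ?mulrS ?mulrDl ?mul1r //; exact: subgroupX.
(* A relation with nonzero [t], or 1 if [t] vanishes throughout. *)
have [r Rr rE] : exists2 r, R r & forall s, R s -> exists n : nat, t s = n%:R * t r.
  have [[r [Rr r0]]|none] := pselect (exists r, R r /\ t r != 0).
    exists r => // s Rs; exists (t s / t r : 'F_p).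
    by rewrite natr_Zp divfK.
  exists 1%g => // s Rs; exists 0%N; rewrite mul0r.
  by apply: contrapT => /eqP ts; apply: none; exists s.
exists r => //; apply/generates_modP => //; first by move=> _ ->.
move=> s Rs; have [n sE] := rE s Rs.
set N := normal_subgroup_gen _; have [[_ NM NV] _] : normal_subgroup N.
  exact: normal_subgroup_gen_normal.
have Nr : N r by apply: normal_subgroup_gen_sub; left.
have Rrn : R (r ^+ n)%g by exact: subgroupX.
rewrite -(mulVKg (r ^+ n)%g s); apply: NM; first exact: (subgroupX n (normal_subgroup_gen_normal _).1).
apply: normal_subgroup_gen_sub; right; apply: tZ; first by apply: RM => //; exact: RV.
apply: (addrI (t (r ^+ n)%g)); rewrite -tM //; last by apply: RM => //; exact: RV.
by rewrite mulVKg addr0 tX.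
Qed.

End MasseyCombination.

Lemma closed_normal_subgroup_gen_min (G : topologicalGroupType) (A B : set G) :
  normal_subgroup B -> closed B -> A `<=` B -> closed_normal_subgroup_gen A `<=` B.
Proof. by move=> nB cB AB; apply: smallest_sub. Qed.

Lemma relations_upto_set (F : topologicalGroupType) (S : nat -> seq F) k A :
  (3 <= k)%N -> S 3 = A -> (forall l, (2 <= l)%N -> l != 3 -> S l = [::]) ->
  relations_upto S k = [set r | r \in A].
Proof.
move=> k3 S3 S0; apply/seteqP; split=> r.
  move=> [m [m2 mk]]; have [->|m3] := eqVneq m 3; first by rewrite S3.
  by rewrite S0.
by move=> rA; exists 3%N; rewrite S3.
Qed.

Lemma relations_upto2 (F : topologicalGroupType) (S : nat -> seq F) :
  S 2 = [::] -> relations_upto S 2 = set0.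
Proof.
move=> S2; apply/seteqP; split=> // r [m [m2 mk]].
by rewrite (_ : m = 2%N) ?S2 //; apply/eqP; rewrite eqn_leq mk.
Qed.

(** * Comparison of the type with the matrix of traces *)

Section Type33.
Context (p : nat) {G : topologicalGroupType}.
Hypothesis p_pr : prime p.
Hypothesis p_gt3 : (3 < p)%N.
Hypothesis G_hausdorff : hausdorff_space G.
Variable chi : 'I_2 -> G -> 'F_p.
Hypothesis chi_basis : H1_basis chi.
Variable f : 'I_2 -> 'I_2 -> G -> 'F_p.
Hypothesis f_cochain : forall i j, cochain (f i j).
Hypothesis f_cup : forall i j s, cup (chi i) (chi j) s = coboundary (f i j) s.

(* The Massey products are defined on [G] alone, so that a relation between their
   traces holds in every minimal presentation as soon as it holds in one. *)
Lemma massey_independent (a b : 'F_p) : zassenhaus_type p G 3 3 -> (a != 0) || (b != 0) ->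
  ~ exists2 h : G -> 'F_p, cochain h & forall s,
     a * massey_cocycle chi f 0 0 1 s + b * massey_cocycle chi f 1 1 0 s = coboundary h s.
Proof.
move=> [F [pi [S [pi_min Smax Ssize]]]] ab rel.
have [y [mu [y_gen mu_hom mu_chi y_dual]]] := magnus_coordinates p_pr pi_min chi_basis.
have van := (mag_comb_vanishes p_pr G_hausdorff pi_min chi_basis f_cochain f_cup mu_hom mu_chi a b).2 rel.
have [r Rr gen] := one_relation_suffices p_pr p_gt3 pi_min chi_basis f_cochain f_cup mu_hom mu_chi
  y_gen y_dual ab van.
have Z3 := relations_zassenhaus3 p_pr p_gt3 pi_min chi_basis f_cochain f_cup mu_hom mu_chi y_gen y_dual.
(* Minimality at level 3 starts from [relations_upto S 2], which is empty, so a single relation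
   would beat the two listed in [S 3]. *)
have [_ _ /(_ [:: r])] := Smax 3%N isT.
rewrite Ssize //= relations_upto2; last by apply/size0nil; rewrite Ssize.
rewrite set0U => Smin; suff : (2 <= 1)%N by [].
apply: Smin; first by move=> s; rewrite inE => /eqP ->; split=> //; exact: Z3.
rewrite (_ : [set s | s \in [:: r]] = [set r]) //.
by apply/seteqP; split=> s /=; rewrite inE => /eqP.
Qed.

Context {F : topologicalGroupType} (pi : F -> G).
Hypothesis pi_min : minimal_presentation p pi 2.
Variable rho : 'I_2 -> F.
Hypothesis rho_gen : hom_ker pi = closed_normal_subgroup_gen (range rho).

Let pi_hom : continuous_hom pi. Proof. by case: pi_min. Qed.
Local Notation R := (hom_ker pi).

Let rhoR i : R (rho i).
Proof. by rewrite rho_gen => B [_]; apply; exists i. Qed.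

Definition massey_matrix : 'M['F_p]_2 := \matrix_(i < 2, j < 2)
  trace_map pi (rho i) (if j == 0 then massey chi f 0 0 1 else massey chi f 1 1 0).

Lemma massey_matrix_comb (mu : F -> discrete_group (magnus 'F_p 2)) :
    continuous_hom mu -> (forall g i, mag1 (mu g) i = chi i (pi g)) ->
  forall (v : 'cV['F_p]_2) i, (massey_matrix *m v) i 0 = mag_comb (v 0 0) (v 1 0) (mu (rho i)).
Proof.
move=> mu_hom mu_chi v i.
have tr := trace_massey p_pr pi_min chi_basis f_cochain f_cup mu_hom mu_chi.
rewrite mxE big_ord_recl big_ord1 !mxE /= !tr //.
rewrite (_ : lift ord0 ord0 = 1); last exact: val_inj.
by rewrite /mag_comb mulrC [X in _ + X]mulrC.
Qed.

(** A kernel vector of the matrix is a functional on $F_3/F_4$ vanishing on both [rho i]. Such a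
    functional excludes the type by [massey_independent]; if none exists, no single relation can
    replace the two. *)
Lemma zassenhaus_type33P : zassenhaus_type p G 3 3 <-> massey_matrix \in unitmx.
Proof.
have [y [mu [y_gen mu_hom mu_chi y_dual]]] := magnus_coordinates p_pr pi_min chi_basis.
have Mv := massey_matrix_comb mu_hom mu_chi.
have Z3 := relations_zassenhaus3 p_pr p_gt3 pi_min chi_basis f_cochain f_cup mu_hom mu_chi y_gen y_dual.
have normal_comb := mag_comb_normal p_pr p_gt3 mu_hom.
split=> [type33|Munit].
  rewrite -unitmx_tr unitmxE unitfE; apply/negP => /det0P [v v0 vM].
  have Mv0 : massey_matrix *m v^T = 0 by apply: trmx_inj; rewrite trmx_mul trmxK vM trmx0.
  have v01 : (v 0 0 != 0) || (v 0 1 != 0).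
    apply: contraNT v0; rewrite negb_or !negbK => /andP [/eqP v0 /eqP v1].
    by apply/eqP/rowP; apply: ord2P; rewrite mxE.
  apply: (massey_independent type33 v01).
  apply/(mag_comb_vanishes p_pr G_hausdorff pi_min chi_basis f_cochain f_cup mu_hom mu_chi) => r.
  rewrite {1}rho_gen => Rr.
  suff [] : zassenhaus p 3 r /\ mag_comb (v 0 0) (v 0 1) (mu r) = 0 by [].
  (* The zeros of the functional in $F_3$ form a closed normal subgroup, so vanishing on the [rho i]
     spreads to all relations. *)
  move: r Rr; apply: closed_normal_subgroup_gen_min.
  - exact: normal_comb.
  - apply: closedI; first exact: zassenhaus_closed.
    apply: (@closed_preimage _ _ mu [set m | mag_comb (v 0 0) (v 0 1) m = 0]).
      exact: mu_hom.1.
    exact: discrete_closed.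
  - move=> _ [i _ <-]; split; first exact: Z3.
    by have := Mv v^T i; rewrite Mv0 !mxE.
pose S k : seq F := if k == 3%N then [:: rho 0; rho 1] else [::].
have S0 l : (2 <= l)%N -> l != 3%N -> S l = [::] by rewrite /S => _ /negbTE ->.
have RZ r : R r -> R r /\ zassenhaus p 3 r by move=> Rr; split=> //; exact: Z3.
exists F, pi, S; split=> //; last by move=> k k2; rewrite /S; case: eqP.
move=> k k2; split.
- rewrite /S; case: eqP => // -> r; rewrite !inE => /orP [] /eqP -> ; exact: RZ.
(* For [k = 2] nothing is listed yet, and nothing is missing: all relations lie in $F_3$. *)
- have [k3|k3] := leqP 3 k; last first.
    have -> : k = 2%N by apply/eqP; rewrite eqn_leq k2 -ltnS k3.
    rewrite relations_upto2; last exact: S0.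
    apply/generates_modP => //; rewrite set0U => r Rr.
    by apply: normal_subgroup_gen_sub; exact: Z3.
  rewrite (relations_upto_set k3 (A := [:: rho 0; rho 1])) //.
  apply/generates_modP => //.
    by move=> r /=; rewrite !inE => /orP [] /eqP ->; exact: rhoR.
  set N := normal_subgroup_gen _.
  have nN : normal_subgroup N by exact: normal_subgroup_gen_normal.
  (* Openness makes [N] closed, so closed normal generation by the [rho i] already gives abstract
     normal generation modulo $F_{k+1}$. *)
  have oN : open N.
    apply: (open_subgroup_sub (zassenhaus_normal p k.+1).1 _ nN.1); last first.
      by move=> z Zz; apply: normal_subgroup_gen_sub; right.
    by apply: (zassenhaus_open p_pr y_gen).
  rewrite rho_gen; apply: closed_normal_subgroup_gen_min => //.
    exact: open_subgroup_closed nN.1 oN.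
  move=> _ [i _ <-]; apply: normal_subgroup_gen_sub; left; move: i.
  by apply: ord2P; rewrite /= !inE eqxx ?orbT.
- move=> s sR; have [k3|k3] := eqVneq k 3%N; last by rewrite S0.
  subst k; rewrite /= relations_upto2; last exact: S0.
  rewrite set0U => gen; rewrite leqNgt; apply/negP => s1.
  (* At most one element of $F_3/F_4$ leaves a nonzero functional vanishing on it: the coordinates
     swapped with one sign, or [(1, 0)] if both are zero. *)
  have [v v0 vs] : exists2 v : 'cV['F_p]_2, v != 0 &
      forall r, r \in s -> mag_comb (v 0 0) (v 1 0) (mu r) = 0.
    have magE a b m : mag_comb a b m = a * mag3 m 0 0 1 + b * mag3 m 1 1 0 by [].
    pose vec (a b : 'F_p) : 'cV['F_p]_2 := \col_i (if i == 0 then a else b).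
    have vec0 a b : (vec a b != 0) = (a != 0) || (b != 0).
      apply/idP/idP; last first.
        move=> /orP [a0|b0]; [apply: contraNneq a0|apply: contraNneq b0] => /matrixP E.
          by have := E 0 0; rewrite !mxE /= => ->.
        by have := E 1 0; rewrite !mxE /= => ->.
      apply: contraR; rewrite negb_or !negbK => /andP [/eqP a0 /eqP b0].
      by apply/eqP/colP => i; rewrite !mxE a0 b0; case: ifP.
    case: s s1 {sR gen} => [|r []] // _.
      by exists (vec 1 0); rewrite ?vec0 ?oner_eq0.
    have [r0|r0] := boolP ((mag3 (mu r) 1 1 0 != 0) || (- mag3 (mu r) 0 0 1 != 0)).
      exists (vec (mag3 (mu r) 1 1 0) (- mag3 (mu r) 0 0 1)); first by rewrite vec0.
      by move=> _ /[!inE] /eqP ->; rewrite magE !mxE /= mulrC mulNr subrr.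
    exists (vec 1 0); first by rewrite vec0 oner_eq0.
    move=> _ /[!inE] /eqP ->; rewrite magE !mxE /= mul0r addr0 mul1r.
    by move: r0; rewrite negb_or !negbK oppr_eq0 => /andP [_ /eqP].
  have nQ := normal_comb (v 0 0) (v 1 0).
  (* If [s] generated the relations modulo $F_4$, the functional would vanish on all of them,
     putting [v] in the kernel of the matrix. *)
  have sub : hom_ker pi `<=` [set h | zassenhaus p 3 h /\ mag_comb (v 0 0) (v 1 0) (mu h) = 0].
    move=> r Rr; have [[Z1 _ _] _] := zassenhaus_normal (G := F) p 4.
    have : normal_subgroup_gen ([set r | r \in s] `|` zassenhaus p 4) r.
      by rewrite gen; exists r => //; exists 1%g => //; rewrite mulg1.
    move: r {Rr}; apply: normal_subgroup_gen_min; first exact: nQ.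
    move=> z [zs|Zz]; first by split; [have [] := sR z zs|exact: vs].
    split; first exact: zassenhausS Zz.
    by rewrite (zassenhaus4_depth p_pr p_gt3 mu_hom Zz) /mag_comb !mag3_1 !mulr0 addr0.
  move: v0; rewrite -(mulKmx Munit v) (_ : _ *m v = 0) ?mulmx0 ?eqxx //.
  by apply/colP => i; rewrite Mv mxE; have [] := sub _ (rhoR i).
Qed.

End Type33.

(** * Automorphisms of the algebraic numbers *)

(** Being finitely generated is the form in which the tower fields are known to be number fields. *)
Definition generated_by (s : seq algC) (L : algC_subfield) : Prop :=
  {subset s <= L} /\ forall M : algC_subfield, {subset s <= M} -> {subset L <= M}.

Lemma fixed_divring_closed (nu : {rmorphism algC -> algC}) :
  divring_closed (fun x : algC => nu x == x).
Proof.
by split=> [|x y /eqP xE /eqP yE|x y /eqP xE /eqP yE];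
  rewrite unfold_in ?rmorph1 ?rmorphB ?fmorph_div ?xE ?yE.
Qed.

Definition fixed_subfield (nu : {rmorphism algC -> algC}) : algC_subfield :=
  AlgCSubfield (fixed_divring_closed nu).

Lemma rat_in_subfield (L : algC_subfield) (a : rat) : ratr a \in L.
Proof. by rewrite rpred_div ?rpred_int. Qed.

Lemma num_field_in_subfield (L : algC_subfield) (Qs : fieldExtType rat)
    (QsC : {rmorphism Qs -> algC}) (s : seq Qs) :
  {in s, forall z, QsC z \in L} -> {in <<1 & s>>%VS, forall a, QsC a \in L}.
Proof.
elim/last_ind: s => [_ a|s z IH sL a].
  by rewrite Fadjoin_nil => /vlineP [k ->]; rewrite alg_num_field fmorph_rat rat_in_subfield.
rewrite adjoin_rcons => /Fadjoin_polyP [q qs ->].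
rewrite horner_coef rmorph_sum rpred_sum // => i _.
rewrite rmorphM rmorphXn rpredM //.
  by apply: IH; [move=> w ws; apply: sL; rewrite mem_rcons inE ws orbT|exact: (polyOverP qs)].
by rewrite rpredX // sL // mem_rcons mem_head.
Qed.

(** Inside a finite Galois extension of $\mathbb{Q}$ containing [L] and [x], the Galois
    correspondence moves [x] while fixing [L]; the automorphism then extends to [algC]. *)
Lemma aut_moving (s : seq algC) (L : algC_subfield) (x : algC) :
    generated_by s L -> x \notin L ->
  exists nu : {rmorphism algC -> algC}, {in L, forall z, nu z = z} /\ nu x != x.
Proof.
move=> [sL genL] xL; pose t := x :: s.
have [z|q qE] := @choice _ _ (fun z (q : {poly rat}) => minCpoly z = map_poly ratr q).
  by have [q [qE _] _] := minCpolyP z; exists q.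
(* The roots of [P0] are all conjugates of [x] and of the generators, so the field they generate is
   a splitting field. *)
pose P0 := \prod_(z <- t) q z.
have P0E : map_poly ratr P0 = \prod_(z <- t) minCpoly z.
  by rewrite rmorph_prod; apply: eq_bigr => z _; rewrite qE.
have [r rE] := closed_field_poly_normal (map_poly (ratr : rat -> algC) P0).
have P0monic : map_poly (ratr : rat -> algC) P0 \is monic.
  by rewrite P0E monic_prod // => z _; exact: minCpoly_monic.
rewrite (monicP P0monic) scale1r in rE.
have tr z : z \in t -> z \in r.
  move=> zt; rewrite -root_prod_XsubC -rE P0E (big_rem z) //= rootM.
  by rewrite root_minCpoly.
have [Qs [QsC [r1 r1E genr]]] := num_field_exists r.
pose PQ := map_poly (in_alg Qs) P0.
have PQE : PQ = \prod_(z <- r1) ('X - z%:P).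
  apply: (map_poly_inj QsC); rewrite -map_poly_comp (eq_map_poly (g := ratr)); last first.
    by move=> a /=; rewrite alg_num_field fmorph_rat.
  rewrite rE rmorph_prod -r1E big_map; apply: eq_bigr => z _.
  by rewrite rmorphB /= map_polyX map_polyC.
have split_ax : FieldExt_isSplittingField _ Qs.
  constructor; exists PQ; last by exists r1; rewrite ?PQE ?eqpxx.
  by apply/polyOverP => i; rewrite coef_map rpredZ ?mem1v.
pose Qn : splittingFieldType rat := HB.pack Qs split_ax.
pose QnC : {rmorphism Qn -> algC} := QsC.
have gal_all (E : {subfield Qn}) : galois E {:Qn}.
  apply/and3P; split; [exact: subvf| |exact: normalFieldf].
  apply/separableP => a _; apply: pcharf0_separable => l.
  by rewrite -(fmorph_pchar QnC) Num.Theory.pchar_num.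
have lift_seq (u : seq algC) : {subset u <= r} -> exists u1 : seq Qn, map QnC u1 = u.
  elim: u => [|z u IH] ur; first by exists [::].
  have : z \in r by apply: ur; exact: mem_head.
  rewrite -r1E => /mapP [z1 _ ->].
  have [|u1 <-] := IH; first by move=> w wu; apply: ur; rewrite inE wu orbT.
  by exists (z1 :: u1).
have [|s1 s1E] := lift_seq s; first by move=> z zs; apply: tr; rewrite inE zs orbT.
have [x1 x1E] : exists x1 : Qn, QnC x1 = x.
  have : x \in r by rewrite tr // mem_head.
  by rewrite -r1E => /mapP [x1 _ ->]; exists x1.
pose E : {subfield Qn} := <<1 & s1>>%AS.
have x1E' : x1 \notin fixedField 'Gal({:Qn} / E)%g.
  rewrite (galois_fixedField (gal_all E)); apply: contra xL => x1in.
  rewrite -x1E; apply: (@num_field_in_subfield L Qn QnC s1) x1in => z zs1.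
  by apply: sL; rewrite -s1E map_f.
have [g gE gx] : exists2 g, g \in 'Gal({:Qn} / E)%g & g x1 != x1.
  apply: contrapT => none; move/negP: x1E'; apply; apply/fixedFieldP; first exact: memvf.
  by move=> g gE; apply: contrapT => /eqP gx; apply: none; exists g.
have [nu nuE] := extend_algC_subfield_aut QnC g.
exists nu; split; last by rewrite -x1E -nuE (inj_eq (fmorph_inj QnC)).
move=> z zL; apply/eqP.
(* It is enough to fix the generators, since the fixed elements form a subfield. *)
apply: (genL (fixed_subfield nu)) zL => w; rewrite -s1E => /mapP [w1 w1s ->].
rewrite unfold_in /= -nuE; apply/eqP; congr (QnC _).
by apply: (fixed_gal (subvf E) gE); exact: seqv_sub_adjoin.
Qed.

Lemma algC_subfield_eq (L M : algC_subfield) : L =i M -> L = M.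
Proof.
case: L M => [P hP] [Q hQ] /= PQ.
have E : P = Q by apply/funext => x; exact: PQ.
by subst Q; congr AlgCSubfield; exact: Prop_irrelevance.
Qed.

(** * Transport of field extensions along automorphisms *)

Lemma preimage_divring_closed (nu : {rmorphism algC -> algC}) (L : algC_subfield) :
  divring_closed (fun x : algC => nu x \in L).
Proof.
split=> [|x y xL yL|x y xL yL]; rewrite unfold_in ?rmorph1 ?rmorphB ?fmorph_div.
- exact: rpred1.
- exact: (rpredB (xL : nu x \in L) (yL : nu y \in L)).
- exact: (rpred_div (xL : nu x \in L) (yL : nu y \in L)).
Qed.

(** Taken at the inverse of an automorphism this is the image field, with membership decided by
    evaluation. *)
Definition preimage_subfield (nu : {rmorphism algC -> algC}) (L : algC_subfield) : algC_subfield :=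
  AlgCSubfield (preimage_divring_closed nu L).

Section EltVal.
Variable L : algC_subfield.
Implicit Types x y : elt L.

Lemma elt_valD x y : elt_val (x + y) = elt_val x + elt_val y.
Proof. exact: (rmorphD (val : elt L -> algC)). Qed.
Lemma elt_valN x : elt_val (- x) = - elt_val x.
Proof. exact: (rmorphN (val : elt L -> algC)). Qed.
Lemma elt_valM x y : elt_val (x * y) = elt_val x * elt_val y.
Proof. exact: (rmorphM (val : elt L -> algC)). Qed.
Lemma elt_val1 : elt_val (1 : elt L) = 1.
Proof. exact: (rmorph1 (val : elt L -> algC)). Qed.
Lemma elt_val_inj : injective (@elt_val L).
Proof. exact: val_inj. Qed.
End EltVal.

Lemma rmorphism_of (R S : nzRingType) (f : R -> S) : f 1 = 1 ->
  {morph f : x y / x + y} -> {morph f : x y / x * y} ->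
  exists g : {rmorphism R -> S}, g =1 f.
Proof.
move=> f1 fD fM.
have f0 : f 0 = 0 by apply: (addrI (f 0)); rewrite -fD !addr0.
have fN x : f (- x) = - f x by apply: (addrI (f x)); rewrite -fD !subrr.
have fB : zmod_morphism f by move=> x y; rewrite fD fN.
have fM1 : monoid_morphism f by [].
pose fZ := GRing.isZmodMorphism.Build R S f fB.
pose fR := GRing.isMonoidMorphism.Build R S f fM1.
by exists (HB.pack f fZ fR : {rmorphism R -> S}).
Qed.

Section Transport.
Variable nu : {rmorphism algC -> algC}.
Local Notation nuI := (algC_invaut nu).
Local Notation image := (preimage_subfield nuI).

Let nuK : cancel nu nuI. Proof. exact: algC_autK. Qed.
Let nuIK : cancel nuI nu. Proof. exact: algC_invautK. Qed.

Fact image_elt_subproof (L : algC_subfield) (x : elt L) : nu (elt_val x) \in image L.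
Proof. by rewrite unfold_in /= nuK; exact: eltP. Qed.
Definition image_elt (L : algC_subfield) (x : elt L) : elt (image L) := Elt (image_elt_subproof x).

Fact coimage_elt_subproof (L : algC_subfield) (x : elt (image L)) : nuI (elt_val x) \in L.
Proof. exact: eltP x. Qed.
Definition coimage_elt (L : algC_subfield) (x : elt (image L)) : elt L :=
  Elt (coimage_elt_subproof x).

Section Elements.
Variable L : algC_subfield.
Let phi := @image_elt L.
Let psi := @coimage_elt L.

Lemma image_eltK : cancel phi psi.
Proof. by move=> x; apply: elt_val_inj; rewrite /= nuK. Qed.
Lemma coimage_eltK : cancel psi phi.
Proof. by move=> x; apply: elt_val_inj; rewrite /= nuIK. Qed.
Lemma image_eltD : {morph phi : x y / x + y}.
Proof. by move=> x y; apply: elt_val_inj; rewrite elt_valD -[LHS]/(nu (elt_val (x + y))) elt_valD rmorphD. Qed.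
Lemma image_eltM : {morph phi : x y / x * y}.
Proof. by move=> x y; apply: elt_val_inj; rewrite elt_valM -[LHS]/(nu (elt_val (x * y))) elt_valM rmorphM. Qed.
Lemma image_elt1 : phi 1 = 1.
Proof. by apply: elt_val_inj; rewrite elt_val1 -[LHS]/(nu (elt_val 1)) elt_val1 rmorph1. Qed.
Lemma coimage_eltD : {morph psi : x y / x + y}.
Proof. by move=> x y; apply: elt_val_inj; rewrite elt_valD -[LHS]/(nuI (elt_val (x + y))) elt_valD rmorphD. Qed.
Lemma coimage_eltM : {morph psi : x y / x * y}.
Proof. by move=> x y; apply: elt_val_inj; rewrite elt_valM -[LHS]/(nuI (elt_val (x * y))) elt_valM rmorphM. Qed.
End Elements.

Lemma image_degree (L M : algC_subfield) n : degree L M n -> degree (image L) (image M) n.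
Proof.
move=> [LM [b bP]]; split=> [x xL|]; first exact: (LM (nuI x) xL).
exists (fun i => image_elt (b i)) => x.
have [c [cE cU]] := bP (coimage_elt x).
exists [ffun i => image_elt (c i)]; split=> [|c' c'E].
  apply: (fmorph_inj nuI); rewrite [LHS]cE rmorph_sum; apply: eq_bigr => i _.
  by rewrite rmorphM ffunE /= !nuK.
apply/ffunP => i; rewrite ffunE (cU [ffun i => coimage_elt (c' i)]) ?ffunE ?coimage_eltK //.
rewrite /= c'E rmorph_sum; apply: eq_bigr => j _.
by rewrite rmorphM ffunE /= nuK.
Qed.

Lemma image_automorphism (L M : algC_subfield) (s : galois_group L M) :
  automorphism_over (image L) (fun x : elt (image M) => image_elt (s (coimage_elt x))).
Proof.
have [sD sM [t st ts] sL] := galP s; split.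
- by move=> x y; rewrite coimage_eltD sD image_eltD.
- by move=> x y; rewrite coimage_eltM sM image_eltM.
- exists (fun x => image_elt (t (coimage_elt x))) => x.
    by rewrite image_eltK st coimage_eltK.
  by rewrite image_eltK ts coimage_eltK.
- by move=> x xL; rewrite sL ?coimage_eltK.
Qed.

Lemma coimage_automorphism (L M : algC_subfield) (s : galois_group (image L) (image M)) :
  automorphism_over L (fun x : elt M => coimage_elt (s (image_elt x))).
Proof.
have [sD sM [t st ts] sL] := galP s; split.
- by move=> x y; rewrite image_eltD sD coimage_eltD.
- by move=> x y; rewrite image_eltM sM coimage_eltM.
- exists (fun x => coimage_elt (t (image_elt x))) => x.
    by rewrite coimage_eltK st image_eltK.
  by rewrite coimage_eltK ts image_eltK.
- by move=> x xL; rewrite sL ?image_eltK // unfold_in /= nuK.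
Qed.

Lemma image_galois (L M : algC_subfield) : galois_extension L M ->
  galois_extension (image L) (image M).
Proof.
move=> [LM fixL]; split=> [x xL|x xfix]; first exact: (LM (nuI x) xL).
apply: (fixL (coimage_elt x)) => s; have := xfix (Defs.Gal (image_automorphism s)).
by move=> /(congr1 (@coimage_elt M)); rewrite /= image_eltK.
Qed.

Lemma image_abelian (L M : algC_subfield) :
  (forall s t : galois_group L M, (s * t)%g = (t * s)%g) ->
  forall s t : galois_group (image L) (image M), (s * t)%g = (t * s)%g.
Proof.
move=> ab s t; apply: gal_eq => x /=.
have := congr1 (fun u : galois_group L M => image_elt (u (coimage_elt x)))
  (ab (Defs.Gal (coimage_automorphism s)) (Defs.Gal (coimage_automorphism t))).
by rewrite /= !coimage_eltK.
Qed.

Lemma image_integers (L : algC_subfield) x : integers (image L) (nu x) <-> integers L x.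
Proof. by rewrite /integers /= unfold_in /= nuK Aint_aut. Qed.

Local Notation comap I := [set x | I (nu x)].

Lemma comap_ideal_mul (I J : set algC) x : ideal_mul I J (nu x) -> ideal_mul (comap I) (comap J) x.
Proof.
move=> [n [a [b [aI bJ xE]]]]; exists n, (fun i => nuI (a i)), (fun i => nuI (b i)).
split=> [i|i|] /=; rewrite ?nuIK //.
rewrite -[x]nuK xE rmorph_sum; apply: eq_bigr => i _; exact: rmorphM.
Qed.

Lemma ideal_mul_mono (I J I' J' : set algC) : I `<=` I' -> J `<=` J' ->
  ideal_mul I J `<=` ideal_mul I' J'.
Proof.
by move=> II JJ x [n [a [b [aI bJ xE]]]]; exists n, a, b; split=> // i; [exact: II|exact: JJ].
Qed.

Lemma comap_prime (L : algC_subfield) P :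
  nonzero_prime_ideal (image L) P -> nonzero_prime_ideal L (comap P).
Proof.
move=> [[[PZ P0 PD PM] [z Pz z0]] P1 Ppr]; split.
- split; last by exists (nuI z); rewrite /= ?nuIK // fmorph_eq0.
  split=> [x /PZ /image_integers //||x y Px Py|a x La Px] /=.
  + by rewrite rmorph0.
  + by rewrite rmorphD; exact: PD.
  + by rewrite rmorphM; apply: PM => //; exact/image_integers.
- by rewrite /= rmorph1.
- move=> x y Lx Ly; rewrite /= rmorphM; apply: Ppr; exact/image_integers.
Qed.

(** Primes of the image field pull back along [nu], and its complex embeddings are composed with
    [nu]. *)
Lemma image_unramified (L M : algC_subfield) : unramified L M -> unramified (image L) (image M).
Proof.
move=> [unr real]; split=> [P Ppr Psub|f fL x].
  apply: (unr _ (comap_prime Ppr)) => x [Px Lx].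
  have /comap_ideal_mul : ideal_pow (image M) P 2 (nu x).
    by apply: Psub; split=> //; exact/image_integers.
  apply: ideal_mul_mono => // y /comap_ideal_mul; apply: ideal_mul_mono => // z.
  by move=> /image_integers.
have [|||g gE] := @rmorphism_of (elt M) algC (fun x => f (image_elt x)).
- by rewrite image_elt1 rmorph1.
- by move=> a b; rewrite image_eltD rmorphD.
- by move=> a b; rewrite image_eltM rmorphM.
rewrite -(coimage_eltK x) -gE; apply: real => y yL; rewrite gE.
by apply: fL; rewrite unfold_in /= nuK.
Qed.

Lemma image_unramified_abelian p (L M : algC_subfield) :
  unramified_abelian_p_extension p L M ->
  unramified_abelian_p_extension p (image L) (image M).
Proof.
move=> [[k dk] gal ab unr]; split.
- by exists k; exact: image_degree.
- exact: image_galois.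
- exact: image_abelian.
- exact: image_unramified.
Qed.

End Transport.

(** * Finiteness of the tower *)

Lemma galois_group_hausdorff (L E : algC_subfield) : hausdorff_space (galois_group L E).
Proof.
rewrite open_hausdorff => s t st.
have [x sx] : exists x, s x <> t x.
  apply: contrapT => eq; move/eqP: st; apply; apply: gal_eq => x.
  by apply: contrapT => neq; apply: eq; exists x.
exists ([set u : galois_group L E | u x = s x], [set u : galois_group L E | u x = t x]).
  by split; rewrite inE.
split; [exact: open_gal_subbase|exact: open_gal_subbase|].
by apply/eqP; rewrite -subset0 => u /= [us ut]; apply: sx; rewrite -us.
Qed.

Section GeneratedFields.

Lemma rationals_generated : generated_by [::] rationals.
Proof. by split=> // M _ x /CratP [a ->]; exact: rat_in_subfield. Qed.

Lemma degree_generated (L E : algC_subfield) s n : generated_by s L -> degree L E n ->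
  exists t, generated_by t E.
Proof.
move=> [sL genL] [LE [b bP]]; exists (s ++ [seq elt_val (b i) | i <- enum 'I_n]); split.
  move=> z; rewrite mem_cat => /orP [/sL /LE //|/mapP [i _ ->]]; exact: eltP.
move=> M sM x xE; have [c [xc _]] := bP (Elt xE).
rewrite [x]xc; apply: rpred_sum => i _; apply: rpredM.
  by apply: genL (eltP _) => z zs; apply: sM; rewrite mem_cat zs.
by apply: sM; rewrite mem_cat; apply/orP; right; apply/mapP; exists i; rewrite ?mem_enum.
Qed.

Variables (L E : algC_subfield) (s : seq algC).
Hypothesis sE : generated_by s E.

Let into (z : algC) : elt E := insubd 0 z.

Lemma galois_group_root (g : galois_group L E) z : z \in E ->
  root (minCpoly z) (elt_val (g (into z))).
Proof.
move=> zE; have [gD gM gB gL] := galP g.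
have [|||h hE] := @rmorphism_of (elt E) algC (fun x => elt_val (g x)).
- rewrite (gL 1) ?elt_val1 //; exact: rpred1.
- by move=> x y; rewrite gD elt_valD.
- by move=> x y; rewrite gM elt_valM.
have [q [qE _] _] := minCpolyP z.
have into_z : elt_val (into z) = z by rewrite [LHS]insubdK.
have ratE (k : {rmorphism elt E -> algC}) : map_poly k (map_poly ratr q) = minCpoly z.
  by rewrite qE -map_poly_comp; apply: eq_map_poly => a /=; exact: fmorph_rat.
rewrite -hE -(ratE h) fmorph_root -(fmorph_root (val : elt E -> algC)) ratE.
by rewrite [X in root _ X]into_z root_minCpoly.
Qed.

(** The elements on which two automorphisms agree form a subfield. *)
Lemma galois_group_eq (g h : galois_group L E) :
  {in s, forall z, g (into z) = h (into z)} -> g = h.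
Proof.
move=> gh.
have [gD gM _ gL] := galP g; have [hD hM _ hL] := galP h.
have closed_eq : divring_closed (fun x : algC =>
    `[< exists2 x' : elt E, elt_val x' = x & g x' = h x' >]).
  have sameV (k : galois_group L E) (x' : elt E) : k x'^-1 = (k x')^-1.
    have [kD kM _ kL] := galP k.
    have k1 : k 1 = 1 by apply: kL; rewrite elt_val1 rpred1.
    have k0 : k 0 = 0 by apply: (addrI (k 0)); rewrite -kD !addr0.
    have [->|x0] := eqVneq x' 0; first by rewrite !(invr0, k0).
    have kx0 : k x' != 0.
      apply: contraNneq (oner_neq0 (elt E)) => kx0.
      by rewrite -k1 -(mulfV x0) kM kx0 mul0r.
    by apply: (mulfI kx0); rewrite -kM !mulfV // k1.
  have sameN (k : galois_group L E) (x' : elt E) : k (- x') = - k x'.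
    have [kD _ _ _] := galP k.
    have k0 : k 0 = 0 by apply: (addrI (k 0)); rewrite -kD !addr0.
    by apply: (addrI (k x')); rewrite -kD !subrr.
  split=> [|x y /asboolP [x' <- x'E] /asboolP [y' <- y'E]|x y /asboolP [x' <- x'E] /asboolP [y' <- y'E]].
  - by apply/asboolP; exists 1; rewrite ?elt_val1 // (gL 1) ?(hL 1) ?elt_val1 ?rpred1.
  - apply/asboolP; exists (x' - y'); first by rewrite elt_valD elt_valN.
    by rewrite gD hD !sameN x'E y'E.
  - apply/asboolP; exists (x' / y').
      by rewrite elt_valM; congr (_ * _); exact: (fmorphV (val : elt E -> algC)).
    by rewrite gM hM !sameV x'E y'E.
apply: gal_eq => x.
have : elt_val x \in AlgCSubfield closed_eq.
  apply: (sE.2) (eltP x) => z zs; apply/asboolP; exists (into z); last exact: gh.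
  by rewrite [LHS]insubdK //; exact: sE.1.
by move=> /asboolP [x' /elt_val_inj ->].
Qed.

(** An automorphism is determined by its values on the generators, and each value is a root of a
    fixed minimal polynomial. *)
Lemma galois_group_finite : finite_set [set: galois_group L E].
Proof.
pose ev (u : seq algC) (g : galois_group L E) := [seq elt_val (g (into z)) | z <- u].
have fin (u : seq algC) : {subset u <= E} -> finite_set (range (ev u)).
  elim: u => [|z u IH] uE.
    by apply: (sub_finite_set (B := [set [::]])) => [_ [g _ <-] //|]; exact: finite_set1.
  have [r rE] := closed_field_poly_normal (minCpoly z).
  apply: (sub_finite_set (B := [set a :: l | a in [set` r] & l in range (ev u)])).
    move=> _ [g _ <-]; exists (elt_val (g (into z))).
      have := @galois_group_root g z (uE _ (mem_head _ _)).
      by rewrite rE (monicP (minCpoly_monic z)) scale1r root_prod_XsubC.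
    by exists (ev u g) => //; exists g.
  apply: finite_image2; first exact: finite_seq.
  by apply: IH => w wu; apply: uE; rewrite inE wu orbT.
have := finite_preimage (f := ev s) (B := range (ev s)).
rewrite (_ : ev s @^-1` _ = setT); last by apply/seteqP; split=> // g _; exists g.
apply; last by apply: fin; exact: sE.1.
move=> g h _ _ /eq_in_map gh; apply: galois_group_eq => z zs.
by apply: elt_val_inj; exact: gh.
Qed.

End GeneratedFields.

(** * Stability and length of the tower *)

Section Tower.
Variables (p : nat) (K : algC_subfield) (T : nat -> algC_subfield).
Hypothesis K_quad : quadratic_imaginary K.
Hypothesis T_tower : p_class_field_tower p K T.

Lemma tower_generated i : exists s, generated_by s (T i).
Proof.
have [T0 TS] := T_tower; elim: i => [|i [s sT]].
  rewrite (algC_subfield_eq T0).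
  by have [dK _] := K_quad; exact: degree_generated rationals_generated dK.
by have [[[k dk] _ _ _] _] := TS i; exact: degree_generated sT dk.
Qed.

Lemma towerS i : {subset T i <= T i.+1}.
Proof. by have [_ /(_ i) [[[k [sub _]] _ _ _] _]] := T_tower. Qed.

Lemma tower_mono i j : (i <= j)%N -> {subset T i <= T j}.
Proof.
move=> /subnK <-; elim: (j - i)%N => // n IH x /IH; exact: towerS.
Qed.

Lemma tower_sub_compositum i : {subset T i <= compositum T}.
Proof. by move=> x xT; apply/asboolP => M TM; exact: (TM i). Qed.

Lemma tower_stable (nu : {rmorphism algC -> algC}) j :
  {in K, forall x, nu x = x} -> {in T j, forall x, nu x \in T j}.
Proof.
have [T0 TS] := T_tower.
elim: j nu => [|j IH] nu nuK x xT.
  by rewrite nuK // -T0.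
have invK : {in K, forall x, algC_invaut nu x = x}.
  by move=> z zK; rewrite -{1}(nuK z zK) algC_autK.
(* Equality of the image with [T j] uses the induction hypothesis for both [nu] and its inverse,
   whence the generalisation over [nu]. *)
have imT : preimage_subfield (algC_invaut nu) (T j) = T j.
  apply: algC_subfield_eq => z; apply/idP/idP => [zT|].
    by rewrite -(algC_invautK nu z); apply: IH.
  exact: IH.
have [unr maxT] := TS j.
have := image_unramified_abelian nu unr; rewrite imT => /maxT; apply.
by rewrite unfold_in /= algC_autK.
Qed.

Lemma compositum_stable (nu : {rmorphism algC -> algC}) :
  {in K, forall x, nu x = x} -> {in compositum T, forall x, nu x \in compositum T}.
Proof.
move=> nuK x /asboolP xE; apply/asboolP => M TM.
apply: (xE (preimage_subfield nu M)) => i z zT; apply: (TM i); exact: tower_stable.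
Qed.

Lemma aut_restricts (nu : {rmorphism algC -> algC}) : {in K, forall x, nu x = x} ->
  exists s : tower_group K T, forall x, elt_val (s x) = nu (elt_val x).
Proof.
move=> nuK; have invK : {in K, forall x, algC_invaut nu x = x}.
  by move=> z zK; rewrite -{1}(nuK z zK) algC_autK.
pose s (x : elt (compositum T)) := Elt (compositum_stable nuK (eltP x)).
pose t (x : elt (compositum T)) := Elt (compositum_stable invK (eltP x)).
have sP : automorphism_over K s.
  split=> [x y|x y||x xK]; last by apply: elt_val_inj; exact: (nuK _ xK).
  - by apply: elt_val_inj; rewrite elt_valD -[LHS]/(nu (elt_val (x + y))) elt_valD rmorphD.
  - by apply: elt_val_inj; rewrite elt_valM -[LHS]/(nu (elt_val (x * y))) elt_valM rmorphM.
  - by exists t => x; apply: elt_val_inj; rewrite /= ?algC_autK ?algC_invautK.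
by exists (Defs.Gal sP).
Qed.

Lemma finite_p_lengthP : finite_p_length T <-> finite_set [set: tower_group K T].
Proof.
have [T0 TS] := T_tower.
split=> [[i Ti]|finG].
  have TiS : T i.+1 = T i by apply: algC_subfield_eq => x; rewrite Ti.
  have stab n : T (i + n)%N = T i.
    elim: n => [|n IH]; first by rewrite addn0.
    apply: algC_subfield_eq => x; apply/idP/idP => xT; last first.
      by rewrite addnS; apply: towerS; rewrite IH.
    (* The next field is again unramified abelian over [T i], so maximality of [T i.+1], equal to
       [T i], absorbs it. *)
    have [unr _] := TS (i + n)%N; have [_ maxT] := TS i.
    rewrite -TiS; rewrite IH -addnS in unr; exact: maxT unr _ xT.
  rewrite /tower_group; have -> : compositum T = T i.
    apply: algC_subfield_eq => x; apply/idP/idP => [/asboolP|]; last exact: tower_sub_compositum.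
    apply=> j; have [ji|/ltnW ij] := leqP j i; first exact: tower_mono.
    by move=> z; rewrite -(subnKC ij) stab.
  by have [s sT] := tower_generated i; exact (@galois_group_finite K (T i) s sT).
apply: contrapT => inf.
(* Each strict step gives an element of the group trivial on [T i] but not on [T i.+1]; a later such
   element is trivial on [T i.+1], so all are distinct. *)
have step i : exists s : tower_group K T, exists x : elt (compositum T),
    [/\ elt_val x \in T i.+1, s x <> x & forall z, elt_val z \in T i -> s z = z].
  have [x xS xT] : exists2 x, x \in T i.+1 & x \notin T i.
    apply: contrapT => none; apply: inf; exists i => x; apply/idP/idP; first exact: towerS.
    by move=> xS; apply: contrapT => /negP xT; apply: none; exists x.
  have [t tT] := tower_generated i.
  have [nu [nuT nux]] := aut_moving tT xT.
  have nuK : {in K, forall z, nu z = z}.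
    by move=> z zK; apply: nuT; apply: (tower_mono (leq0n i)); rewrite T0.
  have [s sE] := aut_restricts nuK.
  exists s, (Elt (tower_sub_compositum xS)); split=> //.
    by move=> /(congr1 (@elt_val _)); rewrite sE /= => /eqP; exact/negP.
  by move=> z zT; apply: elt_val_inj; rewrite sE nuT.
have [s sP] := choice step.
have s_lt i j : (i < j)%N -> s i <> s j.
  move=> ij sij; have [x [xS sx _]] := sP i; have [_ [_ _ fixj]] := sP j.
  by apply: sx; rewrite sij; apply: fixj; exact: tower_mono xS.
have s_inj : injective s.
  move=> i j sij; have [ij|ji|//] := ltngtP i j.
    by case: (s_lt _ _ ij).
  by case: (s_lt _ _ ji).
apply: infinite_nat; rewrite -(preimage_setT s); apply: finite_preimage finG.
by move=> i j _ _; exact: s_inj.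
Qed.

End Tower.

Theorem proposition3p2
  (conj33 : conjecture_33)
  (p : nat) (p_prime : prime p) (p_gt3 : (3 < p)%N)
  (K : algC_subfield) (K_quad : quadratic_imaginary K)
  (K_rank : class_group_prank p K 2)
  (T : nat -> algC_subfield) (T_tower : p_class_field_tower p K T)
  (chi : 'I_2 -> tower_group K T -> 'F_p) (chi_basis : H1_basis chi)
  (F : topologicalGroupType) (pi : F -> tower_group K T)
  (pi_min : minimal_presentation p pi 2)
  (rho : 'I_2 -> F)
  (rho_gen : hom_ker pi = closed_normal_subgroup_gen (range rho))
  (f : 'I_2 -> 'I_2 -> tower_group K T -> 'F_p)
  (f_cochain : forall i j, cochain (f i j))
  (f_cup : forall i j s, cup (chi i) (chi j) s = coboundary (f i j) s) :
  finite_p_length T <->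
  \matrix_(i < 2, j < 2)
     trace_map pi (rho i)
       (if j == 0 then massey chi f 0 0 1 else massey chi f 1 1 0)
    \in unitmx.
Proof.
have p_odd : odd p by case: (even_prime p_prime) p_gt3 => [->|].
have finP := finite_p_lengthP K_quad T_tower.
have type33 := conj33 p K T p_prime p_odd K_quad K_rank T_tower.
have hG : hausdorff_space (tower_group K T) by exact: galois_group_hausdorff.
have matP := zassenhaus_type33P p_prime p_gt3 hG chi_basis f_cochain f_cup pi_min rho_gen.
exact: (iff_trans finP (iff_trans type33 matP)).
Qed.
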